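(* Let $C\subset\mathbf{P}^{n+1}$ be an arithmetically Buchsbaum, non arithmetically Cohen-Macaulay curve, let $X\subset\mathbf{P}^n$ be its general hyperplane section, and let $m_1\ge\cdots\ge m_t$ and $d_1\ge\cdots\ge d_r$ be the shifts of the last and of the first free module in the minimal free resolution of $I_X$. Let $$J=\{\,j\ |\ d_j=m_{k(j)}-n\ \text{ for some } k(j)\,\}\subseteq\{1,\ldots,r\},$$ and for each $j\in J$ let $\mu(j)$ be the number of minimal generators of $I_X$ of degree $d_j$. Then, for $i\in\mathbf{Z}$, $$\dim_k(\mathcal{M}_C)_i=0\quad\text{if } i\ne d_j-1 \text{ for all } j\in J,$$ and for $j\in J$ $$\dim_k(\mathcal{M}_C)_{d_j-1}\le\min\{\dim_k \mathrm{soc}\,H^1_*(\mathcal{I}_X)_{d_j-1},\ \mu(j)\}.$$ Consequently $$\dim_k(\mathcal{M}_C)\le\sum_{j\in J}\min\{\dim_k \mathrm{soc}\,H^1_*(\mathcal{I}_X)_{d_j-1},\ \mu(j)\}.$$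
   Context: $k$ is an algebraically closed field (of arbitrary characteristic). A curve in $\mathbf{P}^{n+1}$ is a non-degenerate, equidimensional, locally Cohen-Macaulay closed subscheme of dimension $1$. Its deficiency module is $\mathcal{M}_C=\bigoplus_{m\in\mathbf{Z}}H^1(\mathbf{P}^{n+1},\mathcal{I}_C(m))$, a graded module over $S=k[x_0,\ldots,x_{n+1}]$. $C$ is arithmetically Cohen-Macaulay if and only if $\mathcal{M}_C=0$; $C$ is arithmetically Buchsbaum if $\mathcal{M}_C$ is annihilated by $(x_0,\ldots,x_{n+1})$. The general hyperplane section of $C$ is $X=C\cap H\subset H\cong\mathbf{P}^n$ for a general hyperplane $H$. With $R=k[x_0,\ldots,x_n]$, the minimal graded free resolution of the saturated ideal $I_X\subset R$ is $0\to\bigoplus_{i=1}^{t}R(-m_i)\to\mathbf{F}_{n-1}\to\cdots\to\mathbf{F}_2\to\bigoplus_{j=1}^{r}R(-d_j)\to I_X\to 0$ (of length $n$). $H^1_*(\mathcal{I}_X)=\bigoplus_{m\in\mathbf{Z}}H^1(\mathbf{P}^n,\mathcal{I}_X(m))$, and $\mathrm{soc}\,H^1_*(\mathcal{I}_X)$ is its socle, i.e. the graded submodule of elements annihilated by $(x_0,\ldots,x_n)$; a subscript denotes the graded component of that degree. *)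

(* Defs.v *)
From HB Require Import structures.
From mathcomp Require Import all_boot all_order all_algebra.
From mathcomp Require Export mpoly.

Set Implicit Arguments.
Unset Strict Implicit.
Unset Printing Implicit Defensive.

Import GRing.Theory.

Local Open Scope ring_scope.
Local Notation "x %:F" := (@FracField.tofrac _ x) : ring_scope.

Definition is_max (Q : nat -> Prop) (d : nat) : Prop :=
  Q d /\ forall e : nat, Q e -> (e <= d)%N.

Definition subp (T : Type) (P Q : T -> Prop) : Prop := forall x, P x -> Q x.

Definition psubp (T : Type) (P Q : T -> Prop) : Prop :=
  subp P Q /\ exists x, Q x /\ ~ P x.

(* A quotient ring A/J is represented by a subring A of an ambient ring T and
   an ideal J of A; primes of A/J are the primes of A containing J. *)
Section Quotient.
Variable T : comNzRingType.
Implicit Types (A J P : T -> Prop) (s : seq T).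

Definition is_ideal A J : Prop :=
  [/\ subp J A, J 0, forall x y, J x -> J y -> J (x + y)
    & forall a x, A a -> J x -> J (a * x)].

Definition is_prime A P : Prop :=
  [/\ is_ideal A P, ~ P 1
    & forall x y, A x -> A y -> P (x * y) -> P x \/ P y].

Definition krull_dim A J : nat -> Prop :=
  is_max (fun d => exists p : nat -> T -> Prop,
    (forall i, (i <= d)%N -> is_prime A (p i) /\ subp J (p i)) /\
    (forall i, (i < d)%N -> psubp (p i) (p i.+1))).

(* the ideal J + (s_0, s_1, ...) of A *)
Definition add_gens A J s (x : T) : Prop :=
  exists (y : T) (c : 'I_(size s) -> T),
    [/\ J y, forall i, A (c i) & x = y + \sum_(i < size s) c i * s`_i].

Definition regular_seq A J s : Prop :=
  (forall i, (i < size s)%N -> forall x, A x ->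
     add_gens A J (take i s) (s`_i * x) -> add_gens A J (take i s) x) /\
  ~ add_gens A J s 1.

(* grade of the ideal P on A/J; its depth if P is the maximal ideal *)
Definition is_depth A J P : nat -> Prop :=
  is_max (fun d => exists s, [/\ size s = d, forall x, x \in s -> P x
                               & regular_seq A J s]).

Definition CM_local A J P : Prop :=
  exists d, krull_dim A J d /\ is_depth A J P d.

End Quotient.

Section Projective.
Variables (k : closedFieldType) (N : nat).
Local Notation S := {mpoly k[N]}.
Local Notation K := {fraction {mpoly k[N]}}.
Implicit Types (I P : S -> Prop) (D : K -> Prop).

Definition whole (_ : S) : Prop := True.

Definition homog_ideal I : Prop :=
  is_ideal whole I /\ forall (f : S) d, I f -> I (pihomog mdeg d f).

Definition saturation I (f : S) : Prop :=
  exists e : nat, forall i : 'I_N, I ('X_i ^+ e * f).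

Definition proj_point P : Prop :=
  [/\ homog_ideal P, is_prime whole P & exists i : 'I_N, ~ P 'X_i].

(* dimension of the closed subset V(I) of Proj S, by chains of points, i.e. of
   irreducible closed subsets *)
Definition proj_dim I : nat -> Prop :=
  is_max (fun d => exists p : nat -> S -> Prop,
    (forall i, (i <= d)%N -> proj_point (p i) /\ subp I (p i)) /\
    (forall i, (i < d)%N -> psubp (p i) (p i.+1))).

(* generic points of the irreducible components of V(I) *)
Definition proj_component I P : Prop :=
  [/\ proj_point P, subp I P
    & forall Q, proj_point Q -> subp I Q -> subp Q P -> subp P Q].

Definition equidim I (d : nat) : Prop :=
  proj_dim I d /\ forall P, proj_component I P -> proj_dim P d.

(* J_P, as a subset of K; in particular S_P = local whole P *)
Definition local (J P : S -> Prop) (z : K) : Prop :=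
  exists f g : S, [/\ J f, ~ P g & z = f%:F / g%:F].

(* the degree 0 part J_(P) of the homogeneous localization *)
Definition hlocal (J P : S -> Prop) (z : K) : Prop :=
  exists (d : nat) (f g : S),
    [/\ J f, ~ P g, f \is d.-homog, g \is d.-homog & z = f%:F / g%:F].

Definition locally_CM I : Prop :=
  forall P, proj_point P -> subp I P ->
    CM_local (hlocal whole P) (hlocal I P) (hlocal P P).

Definition nondegenerate I : Prop :=
  forall f : S, f \is 1.-homog -> I f -> f = 0.

(* closed subschemes of Proj S are given by their saturated ideals *)
Definition curve I : Prop :=
  [/\ homog_ideal I /\ subp (saturation I) I,
      nondegenerate I, equidim I 1 & locally_CM I].

(* S/I is a Cohen-Macaulay ring *)
Definition arith_CM I : Prop :=
  forall P, is_prime whole P -> subp I P ->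
    CM_local (local whole P) (local I P) (local P P).

Definition hdeg (m : int) (z : K) : Prop :=
  exists (d e : nat) (f g : S),
    [/\ f \is d.-homog, g \is e.-homog, g != 0, d%:Z - e%:Z = m
      & z = f%:F / g%:F].

Definition anydeg (_ : K) : Prop := True.

(* Elements of the localization I_g lying in D: these are the sections of the
   sheaf of I, twisted by m, over the open set g <> 0 if D = hdeg m, and the
   direct sum of these over all m if D = anydeg. *)
Definition sections I (g : S) D (z : K) : Prop :=
  (exists (f : S) (e : nat), I f /\ z = f%:F / g%:F ^+ e) /\ D z.

(* Cech 1-cocycles and 1-coboundaries for the covering of Proj S by the open
   sets x_i <> 0; all restriction maps are inclusions of subsets of K. *)
Definition Z1 I D (c : 'M[K]_N) : Prop :=
  (forall i j, sections I ('X_i * 'X_j) D (c i j)) /\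
  (forall i j l, c i l = c i j + c j l).

Definition B1 I D (c : 'M[K]_N) : Prop :=
  exists u : 'I_N -> K,
    (forall i, sections I 'X_i D (u i)) /\ forall i j, c i j = u j - u i.

(* dim_k (Z / (Z :&: B)) = d *)
Definition qdim (Z B : 'M[K]_N -> Prop) (d : nat) : Prop :=
  exists b : 'I_d -> 'M[K]_N,
    let comb (a : 'I_d -> k) := \sum_(i < d) ((a i)%:MP)%:F *: b i in
    [/\ forall i, Z (b i),
        forall a, B (comb a) -> forall i, a i = 0
      & forall c, Z c -> exists a, B (c - comb a)].

(* D = hdeg m: H^1 of the sheaf of I twisted by m; D = anydeg: H^1_* *)
Definition H1_dim I D : nat -> Prop := qdim (Z1 I D) (B1 I D).

Definition soc_cocycle I (m : int) (c : 'M[K]_N) : Prop :=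
  Z1 I (hdeg m) c /\
  forall l : 'I_N, B1 I (hdeg (m + 1)) (('X_l : S)%:F *: c).

Definition soc_H1_dim I (m : int) : nat -> Prop :=
  qdim (soc_cocycle I m) (B1 I (hdeg m)).

Definition arith_Buchsbaum I : Prop :=
  forall (m : int) (c : 'M[K]_N), Z1 I (hdeg m) c ->
  forall l : 'I_N, B1 I (hdeg (m + 1)) (('X_l : S)%:F *: c).

(* A nonempty open subset of the dual projective space contains the locus
   F <> 0 of some nonzero form F; the hyperplane is sum_i a_i x_i = 0. *)
Definition general_hyperplane (Q : 'rV[k]_N -> Prop) : Prop :=
  exists (e : nat) (F : S), [/\ F \is e.-homog, F != 0
    & forall a : 'rV[k]_N, a != 0 -> F.@[a 0] != 0 -> Q a].

(* F_l is the sum of the S(- shift l j) for j < rk l; elements of F_l are row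
   vectors, and diff l : F_(l+1) -> F_l acts by v |-> v *m diff l *)
Record free_complex := FreeComplex {
  rk : nat -> nat;
  shift : forall l, 'I_(rk l) -> int;
  diff : forall l, 'M[S]_(rk l.+1, rk l) }.
Arguments shift : clear implicits.

(* F_0 = S, and 0 -> F_n -> ... -> F_1 -> I -> 0 is a minimal graded free
   resolution *)
Definition minimal_resolution (n : nat) I (F : free_complex) : Prop :=
  [/\ rk F 0 = 1%N /\ (forall j, shift F 0 j = 0),
      forall l, (n < l)%N -> rk F l = 0%N,
      forall l i j,
        diff F l i j != 0 ->
        exists d : nat, d%:Z = shift F l.+1 i - shift F l j /\ diff F l i j \is d.-homog,
      forall l i j, (diff F l i j)@_0%MM = 0
    & (forall f : S, I f <-> exists v : 'rV_(rk F 1), v *m diff F 0 = const_mx f) /\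
      (forall l (v : 'rV_(rk F l.+1)),
         v *m diff F l = 0 <-> exists w, v = w *m diff F l.+1)].

End Projective.
Arguments shift {k N} f l _.
Arguments anydeg {k N} _.

(* The columns of A parametrize a hyperplane H; the ideal of V(I) :&: H in the
   coordinates of H. *)
Definition hyperplane_section (k : closedFieldType) (n : nat)
    (A : 'M[k]_(n.+1, n)) (I : {mpoly k[n.+1]} -> Prop) : {mpoly k[n]} -> Prop :=
  saturation (fun g => exists f, I f /\
    g = comp_mpoly [tuple \sum_(j < n) A i j *: 'X_j | i < n.+1] f).

(* Main.v *)
(* The proof works with explicit cocycles. Write S and R for the coordinate
   rings of the ambient space and of the hyperplane L = 0, let pi : S -> R be
   restriction, I = I_C and M = M_C.

   For general L, multiplication by L is injective on S/I. This is a Noetherian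
   induction that needs no associated primes: if I is not prime, say fg is in I
   but f and g are not, a linear form regular modulo I : f and modulo the
   saturation of I + (f) is regular modulo I; if I is prime, the linear forms in
   I span a proper subspace.

   A cocycle c of M_i is killed by all variables. Writing x_p c as the coboundary
   of u^p, the Koszul differential of (u^p) does not depend on the chart, so it
   glues to a Koszul 2-cocycle with values in I. This identifies the socle of
   H^1_* of a saturated ideal with its second Koszul cohomology. On the
   hyperplane, chasing that class through the resolution F (the polynomial
   Koszul complex is exact below top degree) embeds soc H^1(I_X)_i into the
   constants of F_n, hence into the span of the l with m_l = i + n + 1. On C, the
   same exactness gives forms G_p of degree i + 1 and sections t of O_C(i) with
   x_p t = - G_p modulo I and c = delta t. Then:
   - pi(G_L), where G_L = sum_p a_p G_p for L = sum_p a_p x_p, lies in I_X and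
     determines c modulo pi(I); since the irrelevant ideal multiplies I_X into
     pi(I), M_i has at most as many dimensions as there are generators of I_X of
     degree i + 1;
   - restricting t to the hyperplane embeds M_i into soc H^1(I_X)_i, the kernel
     being L M_(i-1) = 0.
   So M_i vanishes unless i + 1 is both some d_j and some m_l - n. *)

From HB Require Import structures.
Require Import Defs.
From mathcomp Require Import all_boot all_order all_algebra.
From mathcomp Require Import zify ring.
From Stdlib Require Import Classical ClassicalEpsilon.
Set Implicit Arguments.
Unset Strict Implicit.
Unset Printing Implicit Defensive.
Import GRing.Theory.
Local Open Scope ring_scope.
Local Notation "x %:F" := (@FracField.tofrac _ x) : ring_scope.

(** * Generic linear forms are regular modulo a saturated ideal *)

Section Ideals.
Variable A : comNzRingType.
Implicit Types J : A -> Prop.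

Lemma ideal0 J : is_ideal (fun=> True) J -> J 0. Proof. by case. Qed.
Lemma idealD J x y : is_ideal (fun=> True) J -> J x -> J y -> J (x + y).
Proof. by case=> _ _ + _; apply. Qed.
Lemma ideal_mull J a x : is_ideal (fun=> True) J -> J x -> J (a * x).
Proof. by case=> _ _ _; apply. Qed.
Lemma ideal_mulr J a x : is_ideal (fun=> True) J -> J x -> J (x * a).
Proof. by rewrite mulrC; apply: ideal_mull. Qed.
Lemma idealN J x : is_ideal (fun=> True) J -> J x -> J (- x).
Proof. by move=> hJ Jx; rewrite -mulN1r; apply: ideal_mull. Qed.
Lemma idealB J x y : is_ideal (fun=> True) J -> J x -> J y -> J (x - y).
Proof. by move=> hJ Jx Jy; apply: idealD => //; apply: idealN. Qed.
Lemma ideal_sum J (T : finType) (P : pred T) (F : T -> A) :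
  is_ideal (fun=> True) J -> (forall i, P i -> J (F i)) -> J (\sum_(i | P i) F i).
Proof.
move=> hJ hF; apply: big_ind => //; first exact: ideal0.
by move=> x y; apply: idealD.
Qed.
Lemma ideal_addr J x y : is_ideal (fun=> True) J -> J x -> J (x + y) -> J y.
Proof. by move=> hJ Jx Jxy; rewrite -(addKr x y) addrC; apply: idealB. Qed.

Lemma is_idealP J : J 0 -> (forall x y, J x -> J y -> J (x + y)) ->
  (forall a x, J x -> J (a * x)) -> is_ideal (fun=> True) J.
Proof. by move=> h0 hD hM; split=> // a x _; apply: hM. Qed.

(** Quantifying over all ideals avoids finite combinations: a property of the generated elements
    follows by taking for [J] the ideal of elements that have it. *)
Definition gen (P : A -> Prop) (x : A) : Prop :=
  forall J, is_ideal (fun=> True) J -> (forall y, P y -> J y) -> J x.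

Lemma gen_ideal P : is_ideal (fun=> True) (gen P).
Proof.
apply: is_idealP => [J hJ _|x y hx hy J hJ hP|a x hx J hJ hP].
- exact: ideal0.
- by apply: idealD => //; [apply: hx|apply: hy].
- by apply: ideal_mull => //; apply: hx.
Qed.

Lemma gen_sub P x : P x -> gen P x. Proof. by move=> Px J _; apply. Qed.

End Ideals.

(* Noetherianity in the form that passes to polynomial rings most directly. *)
Definition noetherian (A : comNzRingType) : Prop :=
  forall f : nat -> A, exists n, gen (fun x => exists2 i, (i < n)%N & x = f i) (f n).

(** Strong induction on a bound for [m x]. Applied to a bound minus a rank or a cardinality, it also
    produces maximal objects. *)
Lemma ex_min_measure (T : Type) (P : T -> Prop) (m : T -> nat) :
  (exists x, P x) -> exists x, P x /\ forall y, P y -> (m x <= m y)%N.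
Proof.
case=> x Px; have [N] := ubnP (m x).
elim: N x Px => // N IH x Px lt_xN.
have [[y [Py lt_yx]]|nomin] := classic (exists y, P y /\ (m y < m x)%N).
  by apply: (IH y Py); apply: leq_trans lt_yx _.
exists x; split=> // y Py; rewrite leqNgt; apply/negP => lt_yx.
by apply: nomin; exists y.
Qed.

(** * Hilbert's basis theorem and Noetherian induction on ideals *)

Section Hilbert.
Variable A : comNzRingType.
Hypothesis noethA : noetherian A.

Lemma gen_sum n (a : nat -> A) x :
  gen (fun y => exists2 i, (i < n)%N & y = a i) x ->
  exists c : nat -> A, x = \sum_(i < n) c i * a i.
Proof.
move=> hx; apply: (hx (fun x => exists c : nat -> A, x = \sum_(i < n) c i * a i)).
  apply: is_idealP => [|y z [c ->] [d ->]|b y [c ->]].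
  - by exists (fun=> 0); rewrite big1 // => i _; rewrite mul0r.
  - exists (fun i => c i + d i); rewrite -big_split /=.
    by apply: eq_bigr => i _; rewrite mulrDl.
  - exists (fun i => b * c i); rewrite big_distrr /=.
    by apply: eq_bigr => i _; rewrite mulrA.
move=> y [i lt_in ->]; exists (fun j => (j == i)%:R).
rewrite (bigD1 (Ordinal lt_in)) //= eqxx mul1r big1 ?addr0 // => j neq_ji.
by have /negPf-> : (j : nat) != i by []; rewrite mul0r.
Qed.

(** The argument by least degree. If no [f n] lies in the ideal of its predecessors, the union [I]
    of these ideals is not finitely generated, so one can forever choose [g n] in [I] of least size
    outside the ideal of the earlier choices. A relation between leading coefficients then lowers
    the degree of some [g m], against minimality. *)
Theorem hilbert_basis : noetherian {poly A}.
Proof.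
move=> f; apply: NNPP => noF.
have {}noF n : ~ gen (fun x => exists2 i, (i < n)%N & x = f i) (f n).
  by move=> hn; apply: noF; exists n.
pose I g := exists n, gen (fun x => exists2 i, (i < n)%N & x = f i) g.
have genS n m g : (n <= m)%N -> gen (fun x => exists2 i, (i < n)%N & x = f i) g ->
    gen (fun x => exists2 i, (i < m)%N & x = f i) g.
  move=> le_nm hg J hJ hf; apply: hg => // y [i lt_in ->].
  by apply: hf; exists i => //; apply: leq_trans le_nm.
have hI : is_ideal (fun=> True) I.
  apply: is_idealP => [|x y [n hx] [m hy]|a x [n hx]].
  - by exists 0%N; exact: (ideal0 (gen_ideal _)).
  - exists (maxn n m); apply: (idealD (gen_ideal _)).
      by apply: (genS n) => //; rewrite leq_maxl.
    by apply: (genS m) => //; rewrite leq_maxr.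
  - by exists n; apply: (ideal_mull _ (gen_ideal _)).
have step (s : seq {poly A}) : exists g, (forall x, x \in s -> I x) ->
    (I g /\ ~ gen (fun x => x \in s) g) /\
    forall g', I g' /\ ~ gen (fun x => x \in s) g' -> (size g <= size g')%N.
  (* For a list not contained in [I] the claim is vacuous and 0 is a default value, which makes [G]
     a total function on lists. *)
  have [sI|] := classic (forall x, x \in s -> I x); last by exists 0.
  suff ex : exists g, I g /\ ~ gen (fun x => x \in s) g.
    by have [g hg] := ex_min_measure (fun g : {poly A} => size g) ex; exists g.
  have [n hn] : exists n, forall x, x \in s ->
      gen (fun x => exists2 i, (i < n)%N & x = f i) x.
    elim: s sI => [|x s IH] sI; first by exists 0%N.
    have [y ys|n hn] := IH; first by apply: sI; rewrite inE ys orbT.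
    have [m hm] := sI x (mem_head _ _).
    exists (maxn n m) => y; rewrite inE => /predU1P[->|ys].
      by apply: (genS m) => //; rewrite leq_maxr.
    by apply: (genS n); [rewrite leq_maxl|apply: hn].
  exists (f n); split.
    by exists n.+1; apply: gen_sub; exists n.
  by move=> hs; apply: (noF n); apply: hs => //; apply: gen_ideal.
pose G s := proj1_sig (constructive_indefinite_description _ (step s)).
have GP s : (forall x, x \in s -> I x) ->
    (I (G s) /\ ~ gen (fun x => x \in s) (G s)) /\
    forall g', I g' /\ ~ gen (fun x => x \in s) g' -> (size (G s) <= size g')%N.
  exact: (proj2_sig (constructive_indefinite_description _ (step s))).
have [L [L0 LS]] : exists L : nat -> seq {poly A},
    L 0%N = [::] /\ forall n, L n.+1 = rcons (L n) (G (L n)).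
  by exists (fix L n := if n is n'.+1 then rcons (L n') (G (L n')) else [::]).
pose g n := G (L n).
have LP n x : x \in L n <-> exists2 i, (i < n)%N & x = g i.
  elim: n => [|n IH]; first by rewrite L0; split=> // -[].
  rewrite LS mem_rcons in_cons; split=> [/predU1P[->|/IH[i lt_in ->]]|[i]].
  - by exists n.
  - by exists i => //; apply: ltnW.
  rewrite ltnS leq_eqVlt => /predU1P[->->|lt_in ex]; first by rewrite eqxx.
  by apply/orP; right; apply: (proj2 IH); exists i.
have LI n x : x \in L n -> I x.
  elim: n x => [|n IH] x; first by rewrite L0.
  by rewrite LS mem_rcons in_cons => /predU1P[->|/IH//]; case: (GP (L n) IH) => -[].
have gI n : I (g n) by case: (GP (L n) (@LI n)) => -[].
have gN n : ~ gen (fun x => x \in L n) (g n) by case: (GP (L n) (@LI n)) => -[].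
have gmin n g' : I g' -> ~ gen (fun x => x \in L n) g' -> (size (g n) <= size g')%N.
  by move=> Ig' Ng'; case: (GP (L n) (@LI n)) => _; apply.
have [m /gen_sum[c hc]] := noethA (fun i => lead_coef (g i)).
(* Each [g i] is raised to the degree of [g m], so that by the choice of [c] the polynomial [q]
   cancels the leading term of [g m]. The subtraction is not truncated for nonzero [g i], by [le_sz]
   below. *)
pose q := \sum_(i < m) (c i)%:P * 'X^(size (g m) - size (g i)) * g i.
have qL : gen (fun x => x \in L m) q.
  apply: (ideal_sum (gen_ideal _)) => i _; apply: (ideal_mull _ (gen_ideal _)).
  by apply: gen_sub; apply/LP; exists i.
have : (size (g m) <= size (g m - q)%R)%N.
  apply: gmin.
    apply: idealB => //; apply: qL => // x; exact: LI.
  move=> hq; apply: (gN m); rewrite -(subrK q (g m)).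
  exact: (idealD (gen_ideal _)).
have gm0 : g m != 0.
  by apply: contra_not_neq (gN m) => ->; exact: (ideal0 (gen_ideal _)).
have le_sz i : (i < m)%N -> (size (g i) <= size (g m))%N.
  move=> lt_im; apply: gmin => // hgm; apply: (gN m) => J hJ hJL.
  apply: hgm => // x /LP[j lt_ji ->].
  by apply: hJL; apply/LP; exists j => //; apply: ltn_trans lt_im.
have szg : size (g m) = (size (g m)).-1.+1 by rewrite prednK // size_poly_gt0.
apply/negP; rewrite -ltnNge [X in (_ < X)%N]szg ltnS; apply/leq_sizeP => j.
rewrite leq_eqVlt => /predU1P[<-|].
  rewrite coefB -lead_coefE hc coef_sum; apply/eqP; rewrite subr_eq0; apply/eqP.
  apply: eq_bigr => i _; rewrite -mulrA coefCM coefXnM.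
  have le := le_sz i (ltn_ord i).
  have [->|] := eqVneq (g i) 0; first by rewrite lead_coef0 coef0 if_same mulr0.
  rewrite -size_poly_gt0 => gi_gt0; case: ltnP => [|_]; first by lia.
  by rewrite lead_coefE; congr (c i * (g i)`_ _); lia.
rewrite -szg => le_j; apply/leq_sizeP: j le_j.
rewrite (leq_trans (size_polyD _ _)) // geq_max leqnn size_polyN.
apply: (leq_trans (size_sum _ _ _)); apply/bigmax_leqP => i _.
rewrite -mulrA mul_polyC (leq_trans (size_scale_leq _ _)) //.
have [->|gi0] := eqVneq (g i) 0; first by rewrite mulr0 size_poly0.
by rewrite mulrC size_mulXn // subnK // le_sz.
Qed.

End Hilbert.

Lemma noetherian_surj (A B : comNzRingType) (phi : {rmorphism A -> B}) :
  (forall b, exists a, b = phi a) -> noetherian A -> noetherian B.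
Proof.
move=> surj noethA f.
have [g hg] : exists g, forall n, f n = phi (g n).
  exists (fun n => proj1_sig (constructive_indefinite_description _ (surj (f n)))).
  by move=> n; case: constructive_indefinite_description.
have [n hn] := noethA g; exists n => J hJ Jf; rewrite hg.
apply: (hn (fun a => J (phi a))) => [|_ [i lt_in ->]].
  apply: is_idealP => [|x y Jx Jy|a x Jx]; rewrite (raddf0, rmorphD, rmorphM).
  - exact: ideal0.
  - exact: idealD.
  - exact: ideal_mull.
by apply: Jf; exists i.
Qed.

Lemma field_noetherian (k : fieldType) : noetherian k.
Proof.
move=> f; have [f00|f00] := eqVneq (f 0%N) 0.
  by exists 0%N => J hJ _; rewrite f00; apply: ideal0.
exists 1%N => J hJ Jf; rewrite -[f 1%N](divfK f00); apply: ideal_mull => //.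
by apply: Jf; exists 0%N.
Qed.

(** Induction on the number of variables: sending the polynomial variable to the last variable maps
    [{poly {mpoly k[n]}}] onto [{mpoly k[n.+1]}]. *)
Theorem mpoly_noetherian (k : fieldType) (n : nat) : noetherian {mpoly k[n]}.
Proof.
elim: n => [|n IH].
  apply: (@noetherian_surj k {mpoly k[0]} (@mpolyC 0 k)) (@field_noetherian k) => p.
  exists p@_0; apply/mpolyP => m; rewrite mcoeffC.
  have -> : m = 0%MM by apply/mnmP => -[].
  by rewrite eqxx mulr1.
pose phi : {rmorphism {poly {mpoly k[n]}} -> {mpoly k[n.+1]}} :=
  horner_eval ('X_ord_max : {mpoly k[n.+1]}) \o map_poly (@mwiden n k).
apply: (@noetherian_surj _ _ phi) (hilbert_basis IH).
elim/mpolyind => [|c m p _ _ [q ->]]; first by exists 0; rewrite rmorph0.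
suff [r ->] : exists r, 'X_[m] = phi r.
  exists (c%:MP%:P * r + q); rewrite rmorphD rmorphM -mul_mpolyC /=; congr (_ * _ + _).
  by rewrite map_polyC /= mwidenC /horner_eval hornerC.
rewrite mpolyXE_id; apply: (big_ind (fun x => exists r, x = phi r)).
- by exists 1; rewrite rmorph1.
- by move=> _ _ [r ->] [s ->]; exists (r * s); rewrite rmorphM.
move=> i _; suff [r ->] : exists r, 'X_i = phi r by exists (r ^+ m i); rewrite rmorphXn.
have [j ->|->] := unliftP ord_max i; last first.
  by exists 'X; rewrite /= map_polyX /horner_eval hornerX.
exists ('X_j)%:P; rewrite /= map_polyC /= /horner_eval hornerC mwidenX mnmwiden1.
by congr 'X_[mnm1 _]; apply: val_inj; rewrite /= /bump leqNgt ltn_ord.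
Qed.

(** A failure yields, by dependent choice, a strictly ascending chain of counterexamples; the
    elements [f n] witnessing strictness contradict [noetherian]. *)
Lemma noetherian_ideal_ind (A : comNzRingType) (P : (A -> Prop) -> Prop) :
  noetherian A ->
  (forall J, is_ideal (fun=> True) J ->
     (forall J', is_ideal (fun=> True) J' -> psubp J J' -> P J') -> P J) ->
  forall J, is_ideal (fun=> True) J -> P J.
Proof.
move=> noethA step J0 hJ0; apply: NNPP => nPJ0.
pose T := {J : A -> Prop | is_ideal (fun=> True) J /\ ~ P J}.
have next (J : T) : exists J' : T, psubp (sval J) (sval J').
  case: J => J [hJ nPJ] /=; apply: NNPP => noJ'; apply: nPJ; apply: step => // J' hJ' JJ'.
  by apply: NNPP => nPJ'; apply: noJ'; exists (exist _ J' (conj hJ' nPJ')).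
pose nx J := proj1_sig (constructive_indefinite_description _ (next J)).
have nxP J : psubp (sval J) (sval (nx J)).
  exact: (proj2_sig (constructive_indefinite_description _ (next J))).
pose c n := iter n nx (exist _ J0 (conj hJ0 nPJ0) : T).
have cP n : exists x, sval (c n.+1) x /\ ~ sval (c n) x by case: (nxP (c n)).
pose f n := proj1_sig (constructive_indefinite_description _ (cP n)).
have fP n : sval (c n.+1) (f n) /\ ~ sval (c n) (f n).
  exact: (proj2_sig (constructive_indefinite_description _ (cP n))).
have mono n m : (n <= m)%N -> subp (sval (c n)) (sval (c m)).
  elim: m => [|m IHm]; first by rewrite leqn0 => /eqP-> x.
  rewrite leq_eqVlt => /predU1P[->|/IHm h] x // /h.
  by case: (nxP (c m)) => + _; apply.
have [n hn] := noethA f; have [_] := fP n; apply.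
apply: hn => [|_ [i lt_in ->]]; first by case: (svalP (c n)).
by have [+ _] := fP i; apply: mono.
Qed.

(** * Saturated ideals and generic linear forms *)

Section Saturation.
Variables (k : closedFieldType) (N : nat).
Local Notation S := {mpoly k[N]}.
Implicit Types I J : S -> Prop.

Definition saturated I := subp (saturation I) I.

Lemma saturationP I f : is_ideal (fun=> True) I ->
  saturation I f <-> forall i : 'I_N, exists e : nat, I ('X_i ^+ e * f).
Proof.
move=> hI; split=> [[e he] i|]; first by exists e.
move/fin_all_exists => [e he]; exists (\max_i e i)%N => i.
by rewrite -(subnK (leq_bigmax i)) exprD -mulrA; apply: ideal_mull.
Qed.

Lemma saturation_sub I : is_ideal (fun=> True) I -> subp I (saturation I).
Proof. by move=> hI f If; exists 0%N => i; apply: ideal_mull. Qed.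

Lemma saturation_ideal I : is_ideal (fun=> True) I -> is_ideal (fun=> True) (saturation I).
Proof.
move=> hI; apply: is_idealP => [|x y [e hx] [d hy]|a x [e hx]].
- by apply: saturation_sub => //; apply: ideal0.
- apply/saturationP => // i; exists (d + e)%N; rewrite mulrDr; apply: idealD => //.
    by rewrite exprD -mulrA; apply: ideal_mull.
  by rewrite addnC exprD -mulrA; apply: ideal_mull.
- by exists e => i; rewrite mulrCA; apply: ideal_mull.
Qed.

Lemma saturation_saturated I : is_ideal (fun=> True) I -> saturated (saturation I).
Proof.
move=> hI f [e he]; apply/saturationP => // i; have [d hd] := he i.
by exists (d + e)%N; rewrite exprD -mulrA.
Qed.

Definition lin_form (a : 'rV[k]_N) : S := \sum_i a 0 i *: 'X_i.

Lemma lin_form0 : lin_form 0 = 0.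
Proof. by apply: big1 => i _; rewrite mxE scale0r. Qed.

Lemma lin_formD a b : lin_form (a + b) = lin_form a + lin_form b.
Proof.
by rewrite -big_split; apply: eq_bigr => i _ /=; rewrite mxE scalerDl.
Qed.

Lemma lin_formZ c a : lin_form (c *: a) = c *: lin_form a.
Proof.
by rewrite /lin_form scaler_sumr; apply: eq_bigr => i _ /=; rewrite mxE scalerA.
Qed.

Lemma lin_form_delta i : lin_form (delta_mx 0 i) = 'X_i.
Proof.
rewrite /lin_form (bigD1 i) //= mxE !eqxx scale1r big1 ?addr0 // => j /negPf ne.
by rewrite mxE ne andbF scale0r.
Qed.

Lemma meval_lin_form (a b : 'rV[k]_N) : (lin_form a).@[b 0] = \sum_i a 0 i * b 0 i.
Proof. by rewrite raddf_sum; apply: eq_bigr => i _ /=; rewrite mevalZ mevalXU. Qed.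

Lemma lin_form_homog a : lin_form a \is 1.-homog.
Proof. by apply: rpred_sum => i _; apply: rpredZ; rewrite dhomogX /= mdeg1. Qed.

Lemma lin_form_eq0 a : lin_form a = 0 -> a = 0.
Proof.
move=> La0; apply/rowP => i; rewrite mxE.
have := congr1 (mcoeff U_(i)) La0; rewrite raddf0 raddf_sum (bigD1 i) //=.
rewrite mcoeffZ mcoeffXU eqxx mulr1 big1 ?addr0 // => j /negPf ne.
by rewrite mcoeffZ mcoeffXU ne mulr0.
Qed.

Definition nonzerodivisor I f := forall g, I (f * g) -> I g.

(** A matrix [A] of maximal rank with rows in [V] has row space [V], since stacking a missing vector
    would raise the rank. A column of its cokernel matrix that does not kill [v] gives [phi]. *)
Lemma proper_subspace_separated (V : 'rV[k]_N -> Prop) v :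
  V 0 -> (forall c a b, V a -> V b -> V (c *: a + b)) -> ~ V v ->
  exists phi : 'rV[k]_N, phi != 0 /\ forall a, V a -> \sum_i phi 0 i * a 0 i = 0.
Proof.
move=> V0 VD nVv.
have [A [VA maxA]] : exists A : 'M[k]_N, (forall i, V (row i A)) /\
    forall B : 'M[k]_N, (forall i, V (row i B)) -> (N - \rank A <= N - \rank B)%N.
  apply: (ex_min_measure (fun B : 'M[k]_N => N - \rank B)%N).
  by exists 0 => i; rewrite row0.
have subV m (B : 'M[k]_(m, N)) a : (forall i, V (row i B)) -> (a <= B)%MS -> V a.
  move=> VB /submxP[D ->]; rewrite mulmx_sum_row.
  by apply: (big_ind V) => // [x y Vx Vy|i _]; [rewrite -(scale1r x)|rewrite -[X in V X]addr0]; apply: VD.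
have VsubA a : V a -> (a <= A)%MS.
  move=> Va; have VB i : V (row i <<col_mx A a>>%MS).
    apply: (@subV _ (col_mx A a)); last by rewrite (submx_trans (row_sub _ _)) ?genmxE.
    move=> j; have [j1 ->|j1 ->] := split_ordP j.
      by rewrite rowKu.
    by rewrite rowKd [row _ _]row_id.
  have le := maxA _ VB; rewrite genmxE in le.
  have : (\rank (col_mx A a) <= \rank A)%N.
    by have := rank_leq_col (col_mx A a); have := rank_leq_col A; lia.
  rewrite -addsmxE => leA; have [_ hl] := mxrank_leqif_sup (addsmxSl A a).
  have : (A + a <= A)%MS by rewrite -hl eqn_leq leA mxrankS // addsmxSl.
  by rewrite addsmx_sub => /andP[].
have : ~~ (v <= A)%MS by apply/negP => /(subV _ _ _ VA).
rewrite submxE => /matrix0Pn[i [j ne0]].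
exists (col j (cokermx A))^T; split.
  apply: contraNneq ne0 => phi0; rewrite mxE big1 // => l _.
  by have := congr1 (fun M : 'rV_N => M 0 l) phi0; rewrite !mxE => ->; rewrite mulr0.
move=> a /VsubA; rewrite submxE => /eqP/(congr1 (fun M : 'rV_N => M 0 j)).
rewrite mxE [RHS]mxE => aj; rewrite -[RHS]aj; apply: eq_bigr => l _.
by rewrite !mxE mulrC.
Qed.

Theorem generic_linear_nonzerodivisor I : is_ideal (fun=> True) I -> saturated I ->
  exists (e : nat) (F : S), [/\ F \is e.-homog, F != 0 &
    forall a : 'rV[k]_N, F.@[a 0] != 0 -> nonzerodivisor I (lin_form a)].
Proof.
move: I; apply: (noetherian_ideal_ind (@mpoly_noetherian k N)) => I hI IH satI.
have [I1|nI1] := classic (I 1).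
  exists 0%N, 1; split; [exact: dhomog1|exact: oner_neq0|move=> a _ f _].
  by rewrite -(mulr1 f); apply: ideal_mull.
have [primeI|] := classic (forall f g, I (f * g) -> I f \/ I g).
  (* If every variable were in [I], saturation would put 1 in [I]. So the linear forms in [I] form a
     proper subspace, and [phi] is a nonzero functional vanishing on it: where it does not vanish,
     the linear form is outside the prime [I]. *)
  have [i nIi] : exists i : 'I_N, ~ I 'X_i.
    apply: NNPP => noi; apply: nI1; apply: satI; exists 1%N => i.
    by rewrite expr1 mulr1; apply: NNPP => nIi; apply: noi; exists i.
  have [|||phi [phi0 phiV]] := @proper_subspace_separated (fun a => I (lin_form a)) (delta_mx 0 i).
  - by rewrite lin_form0; apply: ideal0.
  - move=> c a b Ia Ib; rewrite lin_formD lin_formZ -mul_mpolyC.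
    by apply: idealD => //; apply: ideal_mull.
  - by rewrite lin_form_delta.
  exists 1%N, (lin_form phi); split; first exact: lin_form_homog.
    by apply: contra_neq phi0; apply: lin_form_eq0.
  move=> a; rewrite meval_lin_form => /eqP Fa f /primeI[/phiV//|//].
move=> notprime.
have [f [g [Ifg nIf nIg]]] : exists f g, [/\ I (f * g), ~ I f & ~ I g].
  apply: NNPP => nofg; apply: notprime => f g Ifg; apply: NNPP => /not_or_and[nIf nIg].
  by apply: nofg; exists f, g.
pose If h := I (h * f).
pose J h := exists y s, I y /\ h = y + s * f.
have hIf : is_ideal (fun=> True) If.
  apply: is_idealP => [|x y Ix Iy|a x Ix]; rewrite /If.
  - by rewrite mul0r; apply: ideal0.
  - by rewrite mulrDl; apply: idealD.
  - by rewrite -mulrA; apply: ideal_mull.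
have hJ : is_ideal (fun=> True) J.
  apply: is_idealP => [|_ _ [x [s [Ix ->]]] [y [t [Iy ->]]]|a _ [x [s [Ix ->]]]].
  - by exists 0, 0; rewrite mul0r addr0; split=> //; apply: ideal0.
  - by exists (x + y), (s + t); rewrite mulrDl addrACA; split=> //; apply: idealD.
  - by exists (a * x), (a * s); rewrite mulrDr mulrA; split=> //; apply: ideal_mull.
have satIf : saturated If.
  by move=> h [e he]; apply: satI; exists e => i; rewrite mulrA; apply: he.
have IJ : subp I J by move=> x Ix; exists x, 0; rewrite mul0r addr0.
have [|||e1 [F1 [hF1 F10 nzd1]]] := IH If.
- exact: hIf.
- by split=> [x Ix|]; [exact: (ideal_mulr f hI Ix)|exists g; rewrite /If mulrC].
- exact: satIf.
have [|||e2 [F2 [hF2 F20 nzd2]]] := IH (saturation J).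
- exact: saturation_ideal.
- split=> [x /IJ|]; first exact: saturation_sub.
  exists f; split=> //; apply: saturation_sub => //; exists 0, 1.
  by rewrite add0r mul1r; split=> //; apply: ideal0.
- exact: saturation_saturated.
exists (e1 + e2)%N, (F1 * F2); split; [exact: dhomogM|exact: mulf_neq0|].
move=> a; rewrite mevalM mulf_eq0 negb_or => /andP[/nzd1 {}nzd1 /nzd2 {}nzd2] z Iz.
(* From L z in [I], regularity modulo the saturation of [J] gives x_i^e z = y + s f with y in [I].
   Then L s f is in [I], so L s is in I : f, hence s is too, and x_i^e z lies in [I]. *)
have [e he] : saturation J z by apply: nzd2; apply: saturation_sub => //; apply: IJ.
apply: satI; exists e => i; have [y [s [Iy def]]] := he i.
rewrite def; apply: idealD => //; apply: nzd1; rewrite /If -mulrA.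
apply: (@ideal_addr _ _ (lin_form a * y)) => //; first exact: ideal_mull.
by rewrite -mulrDr -def mulrCA; apply: ideal_mull.
Qed.

End Saturation.

(** * Homogeneous components and division by variables *)

Section Graded.
Variables (k : closedFieldType) (N : nat).
Local Notation S := {mpoly k[N]}.
Implicit Types (f g : S) (a b c : int).

(* Degrees are integers here; the zero polynomial is homogeneous of every one
   of them, and the only one that is homogeneous of a negative degree. *)
Definition hz a f : Prop := forall m, f@_m != 0 -> (mdeg m)%:Z = a.

Definition pz a f : S := if a is Posz d then pihomog mdeg d f else 0.

Lemma mcoeff_pz a f m : (pz a f)@_m = if (mdeg m)%:Z == a then f@_m else 0.
Proof.
case: a => d /=; last by rewrite mcoeff0.
rewrite pihomogE raddf_sum /= eqz_nat.
have -> : \sum_(i <- msupp f | mdeg i == d) (f@_i *: 'X_[i])@_m =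
    \sum_(i <- msupp f | (i == m) && (mdeg m == d)) f@_m.
  rewrite big_mkcond [RHS]big_mkcond; apply: eq_bigr => i _.
  rewrite mcoeffZ mcoeffX; have [->|_] := eqVneq i m; first by rewrite mulr1.
  by rewrite mulr0 if_same.
case: eqP => _; last by rewrite big_pred0 // => i; rewrite andbF.
have [ms|] := boolP (m \in msupp f); last first.
  move=> nms; rewrite big1_seq; first by rewrite memN_msupp_eq0.
  by move=> i /andP[/andP[/eqP-> _]]; rewrite (negPf nms).
rewrite (eq_bigl (xpred1 m)); last by move=> i; rewrite andbT.
by rewrite -big_filter filter_pred1_uniq ?msupp_uniq // big_seq1.
Qed.

Lemma hz_pz a f : hz a (pz a f).
Proof. by move=> m; rewrite mcoeff_pz; case: (_ =P a) => // _; rewrite eqxx. Qed.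

Lemma pz_id a f : hz a f -> pz a f = f.
Proof.
move=> hf; apply/mpolyP => m; rewrite mcoeff_pz; case: (_ =P a) => // ne.
by apply/esym/eqP; apply: contraT => /hf.
Qed.

Lemma pz_is_linear a : linear (pz a).
Proof.
move=> c f g; apply/mpolyP => m; rewrite mcoeffD mcoeffZ !mcoeff_pz mcoeffD mcoeffZ.
by case: eqP => // _; rewrite mulr0 addr0.
Qed.
HB.instance Definition _ a := GRing.isLinear.Build k S S _ (pz a) (pz_is_linear a).

Lemma hzP a f : hz a f <-> pz a f = f.
Proof. by split=> [/pz_id//|<-]; apply: hz_pz. Qed.

Lemma hz0 a : hz a 0. Proof. by move=> m; rewrite mcoeff0 eqxx. Qed.
Lemma hzD a f g : hz a f -> hz a g -> hz a (f + g).
Proof. by rewrite !hzP linearD /= => -> ->. Qed.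
Lemma hzB a f g : hz a f -> hz a g -> hz a (f - g).
Proof. by rewrite !hzP linearB /= => -> ->. Qed.
Lemma hzZ a (x : k) f : hz a f -> hz a (x *: f).
Proof. by rewrite !hzP linearZ /= => ->. Qed.
Lemma hz_sum a (T : finType) (P : pred T) (F : T -> S) :
  (forall i, P i -> hz a (F i)) -> hz a (\sum_(i | P i) F i).
Proof.
move=> hF; rewrite hzP linear_sum; apply: eq_bigr => i /hF.
by rewrite hzP.
Qed.

Lemma hz_homog (d : nat) f : f \is d.-homog <-> hz d f.
Proof.
split=> [/dhomogP hf m|hf]; first by rewrite -mcoeff_msupp => /hf ->.
by apply/dhomogP => m; rewrite mcoeff_msupp => /hf [].
Qed.

Lemma hz_nat a f : hz a f -> f = 0 \/ exists d : nat, a = d /\ f \is d.-homog.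
Proof.
move=> hf; have [->|f0] := eqVneq f 0; [by left|right].
have /hf deg_f : f@_(mlead f) != 0 by rewrite mleadc_eq0.
by exists (mdeg (mlead f)); split=> //; rewrite hz_homog deg_f.
Qed.

Lemma hzM a b f g : hz a f -> hz b g -> hz (a + b) (f * g).
Proof.
move=> hf hg m; rewrite -mcoeff_msupp => /msuppM_le/allpairsP[[m1 m2] /= [m1f m2g ->]].
by rewrite mdegD PoszD hf ?hg // -mcoeff_msupp.
Qed.

Lemma hzC (x : k) : hz 0 (x%:MP : S).
Proof.
move=> m; rewrite mcoeffC; have [->|_] := eqVneq m 0%MM; first by rewrite mdeg0.
by rewrite mulr0 eqxx.
Qed.

Lemma hzX i : hz 1 'X_i.
Proof. by apply/hz_homog; rewrite dhomogX /= mdeg1. Qed.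

Lemma hzXn (e : nat) a f : hz a f -> hz (e%:Z * a) (f ^+ e).
Proof.
move=> hf; elim: e => [|e IH]; first by rewrite expr0 mul0r; apply: hzC.
by rewrite exprS intS mulrDl mul1r; apply: hzM.
Qed.

Lemma hzVn (e : nat) i : hz e ('X_i ^+ e).
Proof. by rewrite -[e%:Z]mulr1; apply: hzXn; apply: hzX. Qed.

(** A monomial of degree b + a in the product takes degree [b] from [g], which leaves degree [a] for
    [f]; the other components of [f] contribute nothing. *)
Lemma pzM a b f g : hz b g -> pz (b + a) (g * f) = g * pz a f.
Proof.
move=> hg; rewrite -[f in LHS](subrK (pz a f)) mulrDr linearD /=.
rewrite [X in _ + X]pz_id; last by apply: hzM => //; apply: hz_pz.
rewrite [X in X + _](_ : _ = 0) ?add0r //.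
apply/mpolyP => m; rewrite mcoeff_pz mcoeff0; case: eqP => // deg_m; apply/eqP.
apply: contraT; rewrite -mcoeff_msupp => /msuppM_le/allpairsP[[m1 m2] /= [m1g]].
rewrite mcoeff_msupp mcoeffB mcoeff_pz => m2f def_m; move: m2f.
case: (_ =P a) => [|ne]; first by rewrite subrr eqxx.
case: ne; apply: (addrI b); rewrite -deg_m def_m mdegD PoszD; congr (_ + _).
by apply/esym/hg; rewrite -mcoeff_msupp.
Qed.

Lemma hz_divl b c f g : g != 0 -> hz b g -> hz (b + c) (g * f) -> hz c f.
Proof.
move=> g0 hg; rewrite !hzP pzM // => /(mulfI g0); exact.
Qed.

Lemma pz_ideal (I : S -> Prop) a f : homog_ideal I -> I f -> I (pz a f).
Proof.
case=> hI homI If; case: a => d /=; first exact: homI.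
exact: ideal0.
Qed.

Lemma sum_pz f : f = \sum_(d < msize f) pz d f.
Proof. by rewrite /= -pihomog_partitionE. Qed.

End Graded.
Arguments hz0 [k N] a.
Arguments hzX [k N] i.
Arguments hzVn [k N] e i.
Arguments hzC [k N] x.
Arguments hz_pz [k N] a f.

(** * Remainder and quotient by one variable *)

Section DivideByVariable.
Variables (k : closedFieldType) (N : nat).
Local Notation S := {mpoly k[N]}.
Implicit Types (f g : S) (i j : 'I_N).

Lemma mcoeffXM j f m :
  ('X_j * f)@_m = if m j == 0%N then 0 else f@_(m - U_(j))%MM.
Proof.
have [mj|mj] := eqVneq (m j) 0%N; last first.
  by rewrite [_ * f]mulrC -[X in _@_X](@submK _ U_(j) m) ?lep1mP // addmC mcoeffMX.
apply/eqP; rewrite mcoeff_eq0; apply/negP => /msuppM_le/allpairsP[[m1 m2] /= []].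
by rewrite msuppX inE => /eqP-> _ def_m; move: mj; rewrite def_m mnmDE mnm1E eqxx.
Qed.

(** Division with remainder by x_i: [rho i] sets x_i to zero and [quo i] is the quotient. Both are
    linear and commute with multiplication by the other variables, which is what the exactness of
    the Koszul complex rests on. *)
Definition rho i f : S := \sum_(m <- msupp f | m i == 0%N) f@_m *: 'X_[m].
Definition quo i f : S := \sum_(m <- msupp f | m i != 0%N) f@_m *: 'X_[m - U_(i)].

Lemma mcoeff_msupp_sum f (P : pred 'X_{1..N}) (h : 'X_{1..N} -> 'X_{1..N}) m m' :
  (forall n, P n -> (h n == m') = (n == m)) -> P m ->
  (\sum_(n <- msupp f | P n) f@_n *: 'X_[h n] : S)@_m' = f@_m.
Proof.
move=> hP Pm; rewrite raddf_sum /= [RHS](_ : _ = \sum_(n <- msupp f | n == m) f@_m).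
  rewrite big_mkcond [RHS]big_mkcond; apply: eq_bigr => n _.
  rewrite mcoeffZ mcoeffX; case: ifPn => [Pn|nPn].
    by rewrite hP //; case: eqP => [->|_]; rewrite ?mulr1 ?mulr0.
  by case: eqP nPn => // ->; rewrite Pm.
have [ms|nms] := boolP (m \in msupp f).
  by rewrite -big_filter filter_pred1_uniq ?msupp_uniq // big_seq1.
by rewrite big1 // memN_msupp_eq0.
Qed.

Lemma mcoeff_rho i f m : (rho i f)@_m = if m i == 0%N then f@_m else 0.
Proof.
case: ifPn => mi; first exact: mcoeff_msupp_sum.
rewrite raddf_sum big1 // => n ni /=; rewrite mcoeffZ mcoeffX.
by have [eq_nm|] := eqVneq n m; [rewrite -eq_nm ni in mi|rewrite mulr0].
Qed.

Lemma mcoeff_quo i f m : (quo i f)@_m = f@_(m + U_(i)).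
Proof.
apply: mcoeff_msupp_sum => [n ni|]; last by rewrite mnmDE mnm1E eqxx addn1.
apply/eqP/eqP => [<-|->]; first by rewrite submK // lep1mP.
by rewrite addmK.
Qed.

Lemma rho_is_linear i : linear (rho i).
Proof.
move=> c f g; apply/mpolyP => m; rewrite mcoeffD mcoeffZ !mcoeff_rho mcoeffD mcoeffZ.
by case: ifP => // _; rewrite mulr0 addr0.
Qed.
HB.instance Definition _ i := GRing.isLinear.Build k S S _ (rho i) (rho_is_linear i).

Lemma quo_is_linear i : linear (quo i).
Proof.
by move=> c f g; apply/mpolyP => m; rewrite mcoeffD mcoeffZ !mcoeff_quo mcoeffD mcoeffZ.
Qed.
HB.instance Definition _ i := GRing.isLinear.Build k S S _ (quo i) (quo_is_linear i).

Lemma rho_quo i f : f = rho i f + 'X_i * quo i f.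
Proof.
apply/mpolyP => m; rewrite mcoeffD mcoeff_rho mcoeffXM mcoeff_quo.
by case: eqP => [|/eqP mi]; rewrite ?addr0 // add0r submK // lep1mP.
Qed.

Lemma quoX i f : quo i ('X_i * f) = f.
Proof.
apply/mpolyP => m; rewrite mcoeff_quo mcoeffXM mnmDE mnm1E eqxx addn1 /=.
by rewrite addmK.
Qed.

Lemma quoXM i j f : i != j -> quo i ('X_j * f) = 'X_j * quo i f.
Proof.
move=> /negPf ne; apply/mpolyP => m.
rewrite mcoeff_quo !mcoeffXM mnmDE mnm1E ne addn0 mcoeff_quo; case: eqP => // /eqP mj.
congr (f@_ _); apply/mnmP => l; rewrite !(mnmDE, mnmBE) !mnm1E.
by case: (eqVneq j l) mj => [<-|_] /=; lia.
Qed.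

Lemma rhoX i f : rho i ('X_i * f) = 0.
Proof. by apply/mpolyP => m; rewrite mcoeff_rho mcoeffXM mcoeff0; case: eqP. Qed.

Lemma rhoXM i j f : i != j -> rho i ('X_j * f) = 'X_j * rho i f.
Proof.
move=> /negPf ne; apply/mpolyP => m; rewrite !(mcoeff_rho, mcoeffXM).
rewrite mnmBE mnm1E [j == i]eq_sym ne subn0.
by case: (m i == 0%N); rewrite // if_same.
Qed.

Lemma varX_neq0 i : 'X_i != 0 :> S.
Proof. by rewrite -msupp_eq0 msuppX. Qed.

(** Induction on [d]: setting x_i to zero in the equation leaves x_j^e times [rho i f] equal to 0,
    so x_i divides [f] and one factor cancels. *)
Lemma dvd_var i j (e d : nat) f g :
  i != j -> 'X_j ^+ e * f = 'X_i ^+ d * g -> exists h, f = 'X_i ^+ d * h.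
Proof.
move=> ne; elim: d f g => [|d IH] f g; first by exists f; rewrite expr0 mul1r.
rewrite exprS -mulrA => eq_fg.
have rho_f : rho i f = 0.
  have : rho i ('X_j ^+ e * f) = 0 by rewrite eq_fg rhoX.
  move: (e); elim=> [|d' IHe]; first by rewrite mul1r.
  rewrite exprS -mulrA rhoXM // => /eqP.
  by rewrite mulf_eq0 (negPf (varX_neq0 j)) => /eqP/IHe.
have def_f : f = 'X_i * quo i f by rewrite {1}(rho_quo i f) rho_f add0r.
have [|h hh] := IH (quo i f) g.
  by apply: (mulfI (varX_neq0 i)); rewrite -eq_fg [in RHS]def_f mulrCA.
by exists h; rewrite def_f hh mulrA.
Qed.

End DivideByVariable.

(** * Sections of twisted ideal sheaves *)

Lemma sub_frac (F : fieldType) (a b u v : F) :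
  a != 0 -> b != 0 -> v / b - u / a = (a * v - b * u) / (a * b).
Proof. by move=> a0 b0; field; apply/andP. Qed.

Lemma frac_mull (F : fieldType) (a x y : F) : a != 0 -> (a * x) / (a * y) = x / y.
Proof. by move=> a0; rewrite -mulf_div divff // mul1r. Qed.

Lemma frac_mulr (F : fieldType) (a x y : F) : a != 0 -> (x * a) / (y * a) = x / y.
Proof. by move=> a0; rewrite ![_ * a]mulrC frac_mull. Qed.

Opaque FracField.tofrac FracField.add FracField.mul FracField.inv FracField.opp.

Section Fractions.
Variables (k : closedFieldType) (n : nat).
Local Notation S := {mpoly k[n.+1]}.
Local Notation K := {fraction {mpoly k[n.+1]}}.
Local Notation X i := ('X_i : S).
Implicit Types (f g h : S) (a b m : int) (y z : K) (I : S -> Prop) (i j : 'I_n.+1).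

Lemma tofrac_inj : injective (@FracField.tofrac S).
Proof. by move=> f g /eqP; rewrite tofrac_eq => /eqP. Qed.

Lemma tofrac_neq0 f : f != 0 -> f%:F != 0 :> K.
Proof. by rewrite tofrac_eq0. Qed.

Lemma varF_neq0 i : (X i)%:F != 0 :> K.
Proof. by rewrite tofrac_neq0 // varX_neq0. Qed.

Lemma hdegP m z :
  hdeg m z <-> exists b f g, [/\ hz (m + b) f, hz b g, g != 0 & z = f%:F / g%:F].
Proof.
split=> [[d [e [f [g [/hz_homog hf /hz_homog hg g0 <- ->]]]]]|[b [f [g [hf hg g0 ->]]]]].
  by exists e, f, g; rewrite subrK.
case: (hz_nat hf) => [->|[d [def_d hd]]]; last first.
  case: (hz_nat hg) g0 => [-> /eqP//|[e [def_e he]] g0].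
  by exists d, e, f, g; split=> //; rewrite -def_d -def_e addrK.
(* With numerator 0 the given degrees are lost, so 0 is rewritten as 0/1 or as 0/x_0^(d+1),
   according to the sign of [m], with formal degrees that differ by [m]. *)
rewrite raddf0 mul0r; case: m {f hf} => d.
  by exists d, 0%N, 0, 1; rewrite dhomog0 dhomog1 oner_neq0 subr0 raddf0 mul0r.
exists 0%N, d.+1, 0, (X ord0 ^+ d.+1); rewrite dhomog0 raddf0 mul0r sub0r.
split=> //; last by rewrite expf_neq0 // varX_neq0.
by apply/hz_homog/hzVn.
Qed.

Lemma hdeg_frac m b f g : hz (m + b) f -> hz b g -> g != 0 -> hdeg m (f%:F / g%:F).
Proof. by move=> hf hg g0; apply/hdegP; exists b, f, g. Qed.

(** Cross-multiplying with a homogeneous presentation reduces this to [hz_divl]; the degree can thus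
    be read off over any homogeneous denominator. *)
Lemma hdeg_numer m b f g : hdeg m (f%:F / g%:F) -> hz b g -> g != 0 -> hz (m + b) f.
Proof.
move=> /hdegP[c [f' [g' [hf' hg' g'0 eq_z]]]] hg g0.
move/eqP: eq_z; rewrite eqr_div ?tofrac_neq0 // -!tofracM => /eqP/tofrac_inj eq_z.
apply: (hz_divl g'0 hg'); rewrite mulrC eq_z addrCA addrA [m + c]addrC -addrA [c + _]addrC.
by rewrite -addrA [b + c]addrC addrA; apply: hzM.
Qed.

Lemma hdeg_poly m f : hdeg m (f%:F) <-> hz m f.
Proof.
have h1 : hz 0 (1 : S) by apply: hzC.
split=> [hf|hf].
  rewrite -(addr0 m); apply: hdeg_numer h1 (oner_neq0 _).
  by rewrite tofrac1 divr1.
by rewrite -(divr1 f%:F) -tofrac1; apply: (hdeg_frac _ h1 (oner_neq0 _)); rewrite addr0.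
Qed.

Lemma hdegM a b y z : hdeg a y -> hdeg b z -> hdeg (a + b) (y * z).
Proof.
move=> /hdegP[c [f [g [hf hg g0 ->]]]] /hdegP[d [f' [g' [hf' hg' g'0 ->]]]].
rewrite mulf_div -!tofracM; apply: (@hdeg_frac _ (c + d)); last exact: mulf_neq0.
  by rewrite addrACA; apply: hzM.
exact: hzM.
Qed.

Lemma hdegD m y z : hdeg m y -> hdeg m z -> hdeg m (y + z).
Proof.
move=> /hdegP[c [f [g [hf hg g0 ->]]]] /hdegP[d [f' [g' [hf' hg' g'0 ->]]]].
rewrite addf_div ?tofrac_neq0 // -!tofracM -tofracD.
apply: (@hdeg_frac _ (c + d)); [|exact: hzM|exact: mulf_neq0].
apply: hzD; first by rewrite addrA; apply: hzM.
by rewrite [c + d]addrC addrA; apply: hzM.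
Qed.

Lemma hdegC (x : k) : hdeg 0 ((x%:MP : S)%:F).
Proof. by apply/hdeg_poly; apply: hzC. Qed.

Lemma hdeg0 m : hdeg m (0 : K).
Proof. by rewrite -tofrac0; apply/hdeg_poly; apply: hz0. Qed.

Lemma hdegN m z : hdeg m z -> hdeg m (- z).
Proof.
move=> hz; rewrite -mulN1r -(add0r m); apply: hdegM => //.
by have := hdegC (-1); rewrite mpolyCN tofracN tofrac1.
Qed.

Lemma hdegB m y z : hdeg m y -> hdeg m z -> hdeg m (y - z).
Proof. by move=> hy hz; apply: hdegD => //; apply: hdegN. Qed.

Lemma hdegX i : hdeg 1 ((X i)%:F).
Proof. by apply/hdeg_poly; apply: hzX. Qed.

Lemma hdeg_divX m (e : nat) f i : hz (m + e) f -> hdeg m (f%:F / (X i)%:F ^+ e).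
Proof.
by move=> hf; rewrite -tofracXn; apply: (hdeg_frac hf (hzVn e i)); rewrite expf_neq0 // varX_neq0.
Qed.

(** The condition of [sections] without the degree, so that membership in the localization and
    homogeneity are treated separately. *)
Definition sec I g z := exists (f : S) (e : nat), I f /\ z = f%:F / g%:F ^+ e.

(** Fractions can be expanded by powers of [g]; this provides common denominators for finitely many
    sections. *)
Lemma sec_ge I g z : is_ideal (fun=> True) I -> g != 0 -> sec I g z ->
  exists e0, forall e, (e0 <= e)%N -> exists f, I f /\ z = f%:F / g%:F ^+ e.
Proof.
move=> hI g0 [f [e0 [If ->]]]; exists e0 => e le_e.
exists (g ^+ (e - e0) * f); split; first exact: ideal_mull.
have gF := tofrac_neq0 g0.
have -> : g%:F ^+ e = g%:F ^+ (e - e0) * g%:F ^+ e0 :> K by rewrite -exprD subnK.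
by rewrite tofracM tofracXn (frac_mull _ _ (expf_neq0 (e - e0) gF)).
Qed.

Lemma sec_poly I g f : I f -> sec I g f%:F.
Proof. by move=> If; exists f, 0%N; rewrite expr0 divr1. Qed.

Lemma sec0 I g : is_ideal (fun=> True) I -> sec I g 0.
Proof. by move=> hI; rewrite -tofrac0; exact: (sec_poly _ (ideal0 hI)). Qed.

Lemma sec_whole I g z : sec I g z -> sec (@whole k _) g z.
Proof. by case=> f [e [_ ->]]; exists f, e. Qed.

Lemma secM I g y z : is_ideal (fun=> True) I ->
  sec (@whole k _) g y -> sec I g z -> sec I g (y * z).
Proof.
move=> hI [f [e [_ ->]]] [f' [e' [If' ->]]]; exists (f * f'), (e + e')%N.
by split; [exact: ideal_mull|rewrite tofracM exprD mulf_div].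
Qed.

Lemma secMp I g f z : is_ideal (fun=> True) I -> sec I g z -> sec I g (f%:F * z).
Proof. by move=> hI; apply: secM => //; apply: sec_poly. Qed.

Lemma secD I g y z : is_ideal (fun=> True) I -> g != 0 ->
  sec I g y -> sec I g z -> sec I g (y + z).
Proof.
move=> hI g0 hy hz; have [e1 h1] := sec_ge hI g0 hy; have [e2 h2] := sec_ge hI g0 hz.
have [f [If ->]] := h1 (e1 + e2)%N (leq_addr _ _).
have [f' [If' ->]] := h2 (e1 + e2)%N (leq_addl _ _).
by exists (f + f'), (e1 + e2)%N; split; [exact: idealD|rewrite tofracD mulrDl].
Qed.

Lemma secN I g z : is_ideal (fun=> True) I -> sec I g z -> sec I g (- z).
Proof.
by move=> hI [f [e [If ->]]]; exists (- f), e; rewrite tofracN mulNr; split=> //; apply: idealN.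
Qed.

Lemma secB I g y z : is_ideal (fun=> True) I -> g != 0 ->
  sec I g y -> sec I g z -> sec I g (y - z).
Proof. by move=> hI g0 hy hz; apply: secD => //; apply: secN. Qed.

Lemma sec_sum I g (T : finType) (P : pred T) (F : T -> K) :
  is_ideal (fun=> True) I -> g != 0 ->
  (forall t, P t -> sec I g (F t)) -> sec I g (\sum_(t | P t) F t).
Proof.
move=> hI g0 hF; apply: big_ind => //; first exact: sec0.
by move=> y z; apply: secD.
Qed.

Lemma sec_div I g z : sec I g z -> sec I g (z / g%:F).
Proof.
by move=> [f [e [If ->]]]; exists f, e.+1; split=> //; rewrite exprSr invfM mulrA.
Qed.

Lemma sec_mulr I g h z : is_ideal (fun=> True) I -> h != 0 -> sec I g z -> sec I (g * h) z.
Proof.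
move=> hI h0 [f [e [If ->]]]; exists (f * h ^+ e), e; split; first exact: ideal_mulr.
by rewrite !tofracM tofracXn exprMn (frac_mulr _ _ (expf_neq0 e (tofrac_neq0 h0))).
Qed.

Lemma sec_mull I g h z : is_ideal (fun=> True) I -> h != 0 -> sec I g z -> sec I (h * g) z.
Proof. by rewrite mulrC; apply: sec_mulr. Qed.

(** Regularity passes to the localization: after clearing denominators, [h] times a numerator of [z]
    lies in [I]. *)
Lemma sec_nonzerodivisor I g h z : is_ideal (fun=> True) I -> g != 0 ->
  nonzerodivisor I h -> sec (@whole k _) g z -> sec I g (h%:F * z) -> sec I g z.
Proof.
move=> hI g0 nzd [f [e [_ ->]]] [f' [e' [If']]].
have gF := tofrac_neq0 g0.
rewrite mulrA -tofracM -!tofracXn => /eqP.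
rewrite eqr_div ?tofrac_neq0 ?expf_neq0 // -!tofracM => /eqP/tofrac_inj eq_f.
exists (f * g ^+ e'), (e + e')%N; split.
  by apply: nzd; rewrite mulrA eq_f; apply: ideal_mulr.
by rewrite tofracM !tofracXn exprD (frac_mulr _ _ (expf_neq0 e' gF)).
Qed.

(** Two distinct charts suffice, and n > 0 provides them: if f / x_0^e = g / x_n^d, then x_0^e
    divides f by [dvd_var]. *)
Lemma glue_whole z : (0 < n)%N -> (forall i, sec (@whole k _) (X i) z) -> exists f, z = f%:F.
Proof.
move=> n0 hz; have ne : ord0 != ord_max :> 'I_n.+1 by rewrite -val_eqE /= eq_sym -lt0n.
have [f [e [_ zf]]] := hz ord0; have [g [d [_ zg]]] := hz ord_max.
have /eqP : f%:F / (X ord0)%:F ^+ e = g%:F / (X ord_max)%:F ^+ d by rewrite -zf -zg.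
rewrite -!tofracXn eqr_div ?tofrac_neq0 ?expf_neq0 ?varX_neq0 // -!tofracM.
move=> /eqP/tofrac_inj; rewrite mulrC [g * _]mulrC => /(dvd_var ne)[h def_f].
exists h; rewrite zf def_f tofracM tofracXn mulrC mulKf //.
by rewrite expf_neq0 // varF_neq0.
Qed.

Lemma glue_ideal I f : is_ideal (fun=> True) I -> saturated I ->
  (forall i, sec I (X i) f%:F) -> I f.
Proof.
move=> hI satI hf; apply: satI; apply/saturationP => // i.
have [g [e [Ig def_f]]] := hf i; exists e; suff -> : X i ^+ e * f = g by [].
apply: tofrac_inj; rewrite tofracM def_f tofracXn mulrC mulfVK //.
by rewrite expf_neq0 // varF_neq0.
Qed.

Lemma glue I z : (0 < n)%N -> is_ideal (fun=> True) I -> saturated I ->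
  (forall i, sec I (X i) z) -> exists f, I f /\ z = f%:F.
Proof.
move=> n0 hI satI hz; have [|f def_z] := glue_whole n0 (z := z).
  by move=> i; apply: sec_whole.
by exists f; split=> //; apply: glue_ideal => // i; rewrite -def_z.
Qed.

Definition lc (x : k) (c c' : 'M[K]_n.+1) : 'M[K]_n.+1 := ((x%:MP : S)%:F) *: c + c'.

Definition lclosed (D : K -> Prop) :=
  D 0 /\ forall (x : k) y z, D y -> D z -> D ((x%:MP : S)%:F * y + z).

Lemma lclosed_hdeg m : lclosed (hdeg m).
Proof.
split=> [|x y z hy hz]; first exact: hdeg0.
by apply: hdegD => //; rewrite -(add0r m); apply: hdegM => //; apply: hdegC.
Qed.

Lemma lclosed_any : lclosed anydeg. Proof. by []. Qed.

Lemma Z1_0 I D : is_ideal (fun=> True) I -> lclosed D -> Z1 I D 0.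
Proof.
move=> hI [D0 _]; split=> [i j|i j l]; rewrite !mxE ?addr0 //.
by split=> //; apply: sec0.
Qed.

Lemma B1_0 I D : is_ideal (fun=> True) I -> lclosed D -> B1 I D 0.
Proof.
move=> hI [D0 _]; exists (fun=> 0); split=> [i|i j]; last by rewrite mxE subrr.
by split=> //; apply: sec0.
Qed.

Lemma Z1_lc I D x c c' : is_ideal (fun=> True) I -> lclosed D ->
  Z1 I D c -> Z1 I D c' -> Z1 I D (lc x c c').
Proof.
move=> hI [_ DD] [hc cc] [hc' cc']; split=> [i j|i j l]; rewrite !mxE.
  have [sc Dc] := hc i j; have [sc' Dc'] := hc' i j.
  split; last exact: DD.
  by apply: secD => //; [rewrite mulf_neq0 ?varX_neq0|exact: secMp].
by rewrite (cc i j l) (cc' i j l) mulrDr addrACA.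
Qed.

Lemma B1_lc I D x c c' : is_ideal (fun=> True) I -> lclosed D ->
  B1 I D c -> B1 I D c' -> B1 I D (lc x c c').
Proof.
move=> hI [_ DD] [u [hu cu]] [u' [hu' cu']].
exists (fun i => (x%:MP : S)%:F * u i + u' i); split=> [i|i j].
  have [su Du] := hu i; have [su' Du'] := hu' i.
  split; last exact: DD.
  by apply: secD => //; [rewrite varX_neq0|exact: secMp].
by rewrite !mxE cu cu' mulrBr addrACA -opprD.
Qed.

Lemma B1_any I D c : B1 I D c -> B1 I anydeg c.
Proof. by move=> [u [hu cu]]; exists u; split=> // i; split=> //; case: (hu i). Qed.

(** A primitive may be replaced by its component of degree [m]: over a common exponent [E] the
    numerators are cut down to degree m + E, and the coboundary, being of degree [m] already, does
    not change. *)
Lemma B1_homog I m (c : 'M[K]_n.+1) : homog_ideal I -> (forall i j, hdeg m (c i j)) ->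
  B1 I anydeg c -> B1 I (hdeg m) c.
Proof.
move=> homI hc [u [hu cu]]; have hI : is_ideal (fun=> True) I by case: homI.
have /fin_all_exists[e0 he] : forall i, exists e0, forall e, (e0 <= e)%N ->
    exists f, I f /\ u i = f%:F / (X i)%:F ^+ e.
  by move=> i; apply: sec_ge => //; [rewrite varX_neq0|case: (hu i)].
pose E := (\max_i e0 i)%N.
have /fin_all_exists[f hf] : forall i, exists f, I f /\ u i = f%:F / (X i)%:F ^+ E.
  by move=> i; apply: he; apply: leq_bigmax.
exists (fun i => (pz (m + E) (f i))%:F / (X i)%:F ^+ E); split=> [i|i j].
  split; last exact/hdeg_divX/hz_pz.
  by exists (pz (m + E) (f i)), E; split=> //; apply: pz_ideal => //; case: (hf i).
have [_ ui] := hf i; have [_ uj] := hf j.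
have XE l : (X l)%:F ^+ E != 0 :> K by rewrite expf_neq0 // varF_neq0.
have h2 : hz (m + (E + E)%N) (X i ^+ E * f j - X j ^+ E * f i).
  apply: (@hdeg_numer _ _ _ (X i ^+ E * X j ^+ E)).
  - suff -> : (X i ^+ E * f j - X j ^+ E * f i)%:F / (X i ^+ E * X j ^+ E)%:F = c i j :> K.
      exact: hc.
    by rewrite cu ui uj tofracB !tofracM !tofracXn (sub_frac _ _ (XE i) (XE j)).
  - by rewrite PoszD; apply: hzM; apply: hzVn.
  - by rewrite mulf_neq0 // expf_neq0 // varX_neq0.
have := pz_id h2; rewrite linearB /= PoszD addrCA !pzM; try exact: hzVn.
move=> /(congr1 (@FracField.tofrac _)); rewrite !tofracB !tofracM !tofracXn => eq_c.
by rewrite cu ui uj !(sub_frac _ _ (XE i) (XE j)) -eq_c.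
Qed.

End Fractions.

(** * Dimensions of quotients *)

Section Dimension.
Variable k : fieldType.

(* The quotient of Z by B embeds into k^D: a linear relation avoids choosing
   the lifts that such an embedding is built from. *)
Definition le_dim (V : Type) (op : k -> V -> V -> V) (Z B : V -> Prop) (D : nat) : Prop :=
  exists Rel : V -> 'rV[k]_D -> Prop,
    [/\ forall c, Z c -> exists t, Rel c t,
        forall x c c' t t', Rel c t -> Rel c' t' -> Rel (op x c c') (x *: t + t')
      & forall c, Z c -> Rel c 0 -> B c].

(** Composition of linear relations: [psi] stands for a linear map from Z/B to Z'/B', injective by
    the last hypothesis. *)
Lemma le_dim_pull (V V' : Type) (op : k -> V -> V -> V) (op' : k -> V' -> V' -> V')
    (Z B : V -> Prop) (Z' B' : V' -> Prop) (D : nat) (psi : V -> V' -> Prop) :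
  le_dim op' Z' B' D ->
  (forall c, Z c -> exists c', psi c c') ->
  (forall c c', psi c c' -> Z' c') ->
  (forall x c1 c2 c1' c2', psi c1 c1' -> psi c2 c2' -> psi (op x c1 c2) (op' x c1' c2')) ->
  (forall c c', Z c -> psi c c' -> B' c' -> B c) ->
  le_dim op Z B D.
Proof.
move=> [Rel [tot lin ker]] psi_tot psiZ psi_lin psi_ker.
exists (fun c t => exists c', psi c c' /\ Rel c' t); split.
- move=> c /psi_tot[c' cc']; have [t ct] := tot _ (psiZ _ _ cc').
  by exists t, c'.
- move=> x c1 c2 t1 t2 [c1' [h1 r1]] [c2' [h2 r2]].
  by exists (op' x c1' c2'); split; [exact: psi_lin|exact: lin].
- move=> c Zc [c' [cc' r]]; apply: (psi_ker c c') => //.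
  by apply: ker => //; apply: psiZ cc'.
Qed.

End Dimension.

Section QDim.
Variables (k : closedFieldType) (n : nat).
Local Notation S := {mpoly k[n.+1]}.
Local Notation K := {fraction {mpoly k[n.+1]}}.
Local Notation V := 'M[K]_n.+1.

Definition comb (T : finType) (b : T -> V) (a : T -> k) : V := \sum_i ((a i)%:MP : S)%:F *: b i.

Variables (Z B : V -> Prop).
Hypotheses (Z0 : Z 0) (Zlc : forall x c c', Z c -> Z c' -> Z (lc x c c')).
Hypotheses (B0 : B 0) (Blc : forall x c c', B c -> B c' -> B (lc x c c')).

Lemma comb_ind (P : V -> Prop) (T : finType) (b : T -> V) a : P 0 ->
  (forall x c c', P c -> P c' -> P (lc x c c')) -> (forall i, P (b i)) -> P (comb b a).
Proof.
move=> P0 Plc Pb; rewrite /comb; elim: (index_enum _) => [|i s IH].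
  by rewrite big_nil.
by rewrite big_cons; apply: (Plc (a i)).
Qed.

(** More than [D] classes are related to linearly dependent vectors of k^D; the dependency gives a
    combination related to 0, hence in [B]. *)
Lemma free_le_dim d D (b : 'I_d -> V) : le_dim (@lc k n) Z B D -> (forall i, Z (b i)) ->
  (forall a, B (comb b a) -> forall i, a i = 0) -> (d <= D)%N.
Proof.
move=> [Rel [tot lin ker]] Zb freeb; rewrite leqNgt; apply/negP => lt_Dd.
have /fin_all_exists[t ht] : forall i, exists t, Rel (b i) t by move=> i; apply: tot.
pose T := \matrix_(i < d) t i.
have : kermx T != 0.
  rewrite -mxrank_eq0 mxrank_ker -lt0n subn_gt0.
  by apply: leq_ltn_trans (rank_leq_col _) lt_Dd.
move=> /rowV0Pn[a /sub_kermxP aT0 /rV0Pn[i0 ai0]].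
(* The pair of zeros is obtained as -1 times a related pair plus that same pair. *)
have R00 : Rel 0 0.
  have := lin (-1) _ _ _ _ (ht i0) (ht i0).
  by rewrite /lc mpolyCN tofracN tofrac1 !scaleN1r !addNr.
have Rcomb : Rel (comb b (a 0)) (\sum_i a 0 i *: t i).
  rewrite /comb; elim: (index_enum _) => [|i s IH]; first by rewrite !big_nil.
  by rewrite !big_cons; apply: lin.
have t0 : \sum_i a 0 i *: t i = 0.
  by rewrite -[RHS]aT0 mulmx_sum_row; apply: eq_bigr => i _; rewrite rowK.
rewrite t0 in Rcomb; move/eqP: ai0; apply.
by apply: (freeb (a 0)); apply: ker => //; apply: comb_ind.
Qed.

Lemma qdim_le_dim d D : qdim Z B d -> le_dim (@lc k n) Z B D -> (d <= D)%N.
Proof. by move=> [b [Zb freeb _]] leD; apply: (free_le_dim leD Zb). Qed.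

(** Turns a bound into the existence of a dimension: a largest family independent modulo [B] spans,
    since an element outside its span could be appended. *)
Lemma le_dim_qdim D : le_dim (@lc k n) Z B D -> exists d, (d <= D)%N /\ qdim Z B d.
Proof.
move=> leD.
pose Q d := exists b : 'I_d -> V, (forall i, Z (b i)) /\
  (forall a, B (comb b a) -> forall i, a i = 0).
have QD d : Q d -> (d <= D)%N by move=> [b [Zb freeb]]; apply: (free_le_dim leD Zb).
have [|d [Qd maxd]] := ex_min_measure (P := Q) (fun d => D - d)%N.
  by exists 0%N, (fun=> 0); split=> // a _ [].
exists d; split; first exact: QD.
have nQ : ~ Q d.+1 by move=> QdS; have := maxd _ QdS; have := QD _ QdS; lia.
case: Qd => b [Zb freeb]; exists b; split=> // c Zc; apply: NNPP => noa; apply: nQ.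
exists (fun i => if unlift ord_max i is Some j then b j else c); split=> [i|a].
  by case: unliftP.
move=> Bcomb.
have widenE i : widen_ord (leqnSn d) i = lift ord_max i.
  by apply: val_inj; rewrite /= /bump leqNgt ltn_ord.
have {}Bcomb : B (comb b (fun i => a (lift ord_max i)) + ((a ord_max)%:MP : S)%:F *: c).
  congr (B _) : Bcomb; rewrite /comb big_ord_recr /= unlift_none; congr (_ + _).
  by apply: eq_bigr => i _; rewrite widenE liftK.
have [a0|a0] := eqVneq (a ord_max) 0.
  move: Bcomb; rewrite a0 mpolyC0 tofrac0 scale0r addr0 => /freeb al i.
  by have [j ->|->] := unliftP ord_max i; [exact: al|].
case: noa; exists (fun i => - (a ord_max)^-1 * a (lift ord_max i)).
have := Blc (a ord_max)^-1 Bcomb B0; congr (B _).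
rewrite /lc addr0 scalerDr scalerA -tofracM -mpolyCM mulVf // mpolyC1 tofrac1 scale1r addrC.
congr (_ + _); rewrite -/(comb _ _) /comb -sumrN scaler_sumr; apply: eq_bigr => i _.
by rewrite scalerA -scaleNr -tofracM -tofracN -mpolyCM -mpolyCN mulNr opprK.
Qed.

(** The relation links [c] to every coordinate vector of [c] modulo [B]; coordinates need not be
    unique, as [b] is only a spanning family. *)
Lemma spanned_le_dim (T : finType) (b : T -> V) :
  (forall c, Z c -> exists a, B (c - comb b a)) -> le_dim (@lc k n) Z B #|T|.
Proof.
move=> spanb; exists (fun c t => B (c - comb b (fun i => t 0 (enum_rank i)))); split.
- move=> c /spanb[a Ba]; exists (\row_j a (enum_val j)); congr (B _): Ba; congr (_ - _).
  by apply: eq_bigr => i _; rewrite mxE enum_rankK.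
- move=> x c c' t t' Bc Bc'; have := Blc x Bc Bc'; congr (B _).
  rewrite /lc /comb scalerBr addrACA -opprD scaler_sumr -big_split /=; congr (_ - _).
  apply: eq_bigr => i _; rewrite !mxE scalerA -scalerDl -tofracM -tofracD.
  by rewrite mpolyCD mpolyCM.
- move=> c _; congr (B _); rewrite /comb big1 ?subr0 // => i _.
  by rewrite mxE mpolyC0 tofrac0 scale0r.
Qed.

Lemma qdim_le_dim_self d : qdim Z B d -> le_dim (@lc k n) Z B d.
Proof.
move=> [b [_ _ spanb]]; rewrite -[X in le_dim _ _ _ X](card_ord d).
exact: spanned_le_dim spanb.
Qed.

End QDim.

(** * Koszul complexes *)

(* The Koszul complex on xs with values in M, as an iterated mapping cone: a
   cochain assigns a value to each 0/1-vector b, standing for the basis element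
   of the exterior power indexed by the support of b. *)
Fixpoint kd (A : comNzRingType) (M : lmodType A) (xs : seq A) (w : seq bool -> M)
    (b : seq bool) : M :=
  match xs, b with
  | x :: xs', true :: b' => x *: w (false :: b') - kd xs' (fun c => w (true :: c)) b'
  | x :: xs', false :: b' => kd xs' (fun c => w (false :: c)) b'
  | _, _ => 0
  end.

Local Notation wt b := (count id b).

Section Koszul.
Variables (A : comNzRingType) (M : lmodType A).
Implicit Types (xs : seq A) (w z : seq bool -> M) (b : seq bool).

Lemma kd_ext xs w w' b : size b = size xs ->
  (forall c, size c = size xs -> (wt c).+1 = wt b -> w c = w' c) ->
  kd xs w b = kd xs w' b.
Proof.
elim: xs w w' b => [|x xs IH] w w' [|[] b] //= [sz] eqw.
  rewrite (eqw (false :: b)) //=; last by rewrite sz.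
  by congr (_ - _); apply: IH => // c szc wtc; apply: eqw => /=; lia.
by apply: IH => // c szc wtc; apply: eqw => /=; lia.
Qed.

Lemma kd_eq xs w w' b : size b = size xs ->
  (forall c, size c = size xs -> w c = w' c) -> kd xs w b = kd xs w' b.
Proof. by move=> szb eqw; apply: kd_ext => // c szc _; apply: eqw. Qed.

Lemma kd_lin xs a w w' b : kd xs (fun c => a *: w c + w' c) b = a *: kd xs w b + kd xs w' b.
Proof.
elim: xs w w' b => [|x xs IH] w w' b /=; first by rewrite scaler0 addr0.
case: b => [|[] b]; rewrite ?IH ?scaler0 ?addr0 //.
by rewrite scalerDr !scalerA mulrC scalerBr scalerA opprD addrACA.
Qed.

Lemma kd0 xs b : kd xs (fun=> 0 : M) b = 0.
Proof.
by have := kd_lin xs (-1) (fun=> 0) (fun=> 0) b; rewrite scaler0 addr0 scaleN1r addNr.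
Qed.

Lemma kdB xs w w' b : size b = size xs ->
  kd xs (fun c => w c - w' c) b = kd xs w b - kd xs w' b.
Proof.
move=> szb; have := kd_lin xs (-1) w' w b; rewrite scaleN1r addrC => <-.
by apply: kd_eq => // c _; rewrite scaleN1r addrC.
Qed.

Lemma kdK xs w b : size b = size xs -> kd xs (kd xs w) b = 0.
Proof.
elim: xs w b => [|x xs IH] w [|[] b] //= [sz]; last exact: IH.
rewrite kdB // IH // subr0.
have := kd_lin xs x (fun c => w (false :: c)) (fun=> 0) b; rewrite kd0 addr0 => <-.
by apply/eqP; rewrite subr_eq0; apply/eqP/kd_eq => // c _; rewrite addr0.
Qed.

(** Two predicates are used because multiplication by an entry of [xs] may change the property, for
    instance raise the degree by one. *)
Lemma kd_ind (P Q : M -> Prop) xs w b : Q 0 -> (forall x y, Q x -> Q y -> Q (x - y)) ->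
  (forall x y, x \in xs -> P y -> Q (x *: y)) -> (forall c, P (w c)) -> Q (kd xs w b).
Proof.
move=> Q0 QB; elim: xs w b => [|x xs IH] w b PQ Pw //.
have PQ' (y : A) (z : M) : y \in xs -> P z -> Q (y *: z) by move=> yxs; apply: PQ; rewrite in_cons yxs orbT.
case: b => [|[] b] //=; last exact: IH.
by apply: QB; [apply: PQ; rewrite ?mem_head|apply: IH].
Qed.

(** Cochains live on all 0/1-vectors at once; this projects to exterior degree [p]. *)
Definition trunc (p : nat) z b := if wt b == p then z b else 0.

Lemma kd_trunc xs p z b : size b = size xs ->
  kd xs (trunc p z) b = trunc p.+1 (kd xs z) b.
Proof.
move=> szb; rewrite /trunc; case: eqP => [wtb|wtb].
  by apply: kd_ext => // c _ wtc; rewrite ifT //; lia.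
rewrite -[RHS](kd0 xs b); apply: kd_ext => // c _ wtc.
by rewrite ifN //; apply/eqP; lia.
Qed.

End Koszul.

Lemma kd_morph (A A' : comNzRingType) (M : lmodType A) (M' : lmodType A') (g : A -> A')
    (f : {additive M -> M'}) xs w b :
  (forall x m, x \in xs -> f (x *: m) = g x *: f m) ->
  f (kd xs w b) = kd (map g xs) (fun c => f (w c)) b.
Proof.
elim: xs w b => [|x xs IH] w b fg /=; first by case: b; rewrite raddf0.
have fg' y m : y \in xs -> f (y *: m) = g y *: f m.
  by move=> yxs; apply: fg; rewrite in_cons yxs orbT.
case: b => [|[] b]; rewrite ?raddf0 ?raddfB ?IH //.
by rewrite fg // mem_head.
Qed.

(** An invertible entry makes the Koszul complex contractible: the primitive is the [true] part of
    the cocycle divided by [x]. *)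
Lemma kd_exact_field (F : fieldType) (M : lmodType F) (x : F) xs (w : seq bool -> M) :
  x != 0 -> (forall b, size b = (size xs).+1 -> kd (x :: xs) w b = 0) ->
  exists z, forall b, size b = (size xs).+1 -> w b = kd (x :: xs) z b.
Proof.
move=> x0 cocycle.
exists (fun b => if b is false :: c then x^-1 *: w (true :: c) else 0).
move=> [|[] b] //= [szb]; first by rewrite kd0 subr0 scalerA divff // scale1r.
have /eqP := cocycle (true :: b) (congr1 succn szb); rewrite /= subr_eq0 => /eqP eqw.
have := kd_lin xs x^-1 (fun c => w (true :: c)) (fun=> 0) b.
rewrite kd0 addr0 -eqw scalerA mulVf // scale1r => <-.
by apply: kd_eq => // c _; rewrite addr0.
Qed.

Lemma wt_nseq_false m : wt (nseq m false) = 0%N.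
Proof. by elim: m. Qed.

Lemma wt_eq0 b : wt b = 0%N -> b = nseq (size b) false.
Proof. by elim: b => [|[] b IH] //= /IH {1}->. Qed.

(** The index of the basis element e_p of the first exterior power. *)
Definition bit (T : eqType) (l : seq T) (p : T) : seq bool := [seq q == p | q <- l].

Lemma size_bit (T : eqType) (l : seq T) p : size (bit l p) = size l.
Proof. exact: size_map. Qed.

Lemma bit_notin (T : eqType) (l : seq T) p : p \notin l -> bit l p = nseq (size l) false.
Proof.
elim: l => [|q l IH] //=; rewrite in_cons negb_or => /andP[/negPf ne /IH ->].
by rewrite eq_sym ne.
Qed.

Lemma wt_bit (T : eqType) (l : seq T) p : uniq l -> p \in l -> wt (bit l p) = 1%N.
Proof.
by move=> ul pl; rewrite count_map (eq_count (a2 := pred1 p)) // count_uniq_mem // pl.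
Qed.

Lemma bit_inj (T : eqType) (l : seq T) p q : p \in l -> bit l p = bit l q -> p = q.
Proof. by move=> pl /eq_in_map/(_ p pl); rewrite eqxx => /esym/eqP. Qed.

Lemma wt1_bit (T : eqType) (l : seq T) b : uniq l -> size b = size l -> wt b = 1%N ->
  exists2 p, p \in l & b = bit l p.
Proof.
elim: l b => [|q l IH] [|[] b] //= /andP[ql ul] [szb].
  rewrite add1n => -[/wt_eq0->]; exists q; first exact: mem_head.
  by rewrite eqxx -/(bit l q) bit_notin // szb.
rewrite add0n => /(IH _ ul szb)[p pl ->]; exists p; first by rewrite in_cons pl orbT.
by rewrite [q == p](negPf _) //; apply: contraNneq ql => ->.
Qed.

Section WeightOne.
Variables (A : comNzRingType) (M : lmodType A) (n : nat) (x : 'I_n -> A).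
Local Notation l := (enum 'I_n).
Local Notation xs := [seq x p | p <- l].

Lemma kd_nseq_false (ys : seq A) (w : seq bool -> M) m : kd ys w (nseq m false) = 0.
Proof. by elim: m ys w => [|m IH] [|y ys] w //=. Qed.

Lemma kd_bit_seq (T : eqType) (y : T -> A) (s : seq T) (z : seq bool -> M) p :
  uniq s -> p \in s -> kd [seq y q | q <- s] z (bit s p) = y p *: z (nseq (size s) false).
Proof.
elim: s z => [|q s IH] z //= /andP[qs us]; rewrite in_cons eq_sym.
have [eq_qp _|ne /= ps] := eqVneq q p; last exact: IH.
by rewrite -eq_qp -/(bit s q) bit_notin // kd_nseq_false subr0.
Qed.

Lemma size_enum_map : size xs = n. Proof. by rewrite size_map size_enum_ord. Qed.

Lemma kd_bit (z : seq bool -> M) p : kd xs z (bit l p) = x p *: z (nseq n false).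
Proof. by rewrite kd_bit_seq ?enum_uniq ?mem_enum // size_enum_ord. Qed.

Definition coch1 (u : 'I_n -> M) (b : seq bool) : M := \sum_p if b == bit l p then u p else 0.

Lemma coch1_bit u p : coch1 u (bit l p) = u p.
Proof.
rewrite /coch1 (bigD1 p) //= eqxx big1 ?addr0 // => q /negPf ne.
case: eqP => // /bit_inj eq_pq; move: ne; rewrite eq_pq ?eqxx // mem_enum //.
Qed.

Lemma coch1_wt u b : wt b != 1%N -> coch1 u b = 0.
Proof.
move=> wtb; apply: big1 => p _; case: eqP => // def_b; move: wtb.
by rewrite def_b wt_bit ?enum_uniq // mem_enum.
Qed.

Lemma coch1_lin a u u' b : coch1 (fun p => a *: u p + u' p) b = a *: coch1 u b + coch1 u' b.
Proof.
rewrite /coch1 scaler_sumr -big_split; apply: eq_bigr => p _ /=.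
by case: eqP => _; rewrite ?scaler0 ?addr0.
Qed.

Lemma eq_coch1 u w b : size b = n -> (forall p, w (bit l p) = u p) ->
  (forall c, wt c != 1%N -> w c = 0) -> w b = coch1 u b.
Proof.
move=> szb wu w0; have [wtb|wtb] := eqVneq (wt b) 1%N; last by rewrite coch1_wt ?w0.
have [||p _ ->] := @wt1_bit _ l b _ _ wtb; rewrite ?enum_uniq ?size_enum_ord //.
by rewrite coch1_bit.
Qed.

Definition coch0 (t : M) (b : seq bool) : M := if b == nseq n false then t else 0.

Lemma kd_coch0 t b : size b = n -> kd xs (coch0 t) b = coch1 (fun p => x p *: t) b.
Proof.
move=> szb; have [wtb|wtb] := eqVneq (wt b) 1%N.
  have [||p _ ->] := @wt1_bit _ l b _ _ wtb; rewrite ?enum_uniq ?size_enum_ord //.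
  by rewrite coch1_bit kd_bit /coch0 eqxx.
rewrite coch1_wt // -[RHS](kd0 _ xs b); apply: kd_ext; rewrite ?size_enum_map // => c _ wtc.
rewrite /coch0; case: eqP wtc => // ->; rewrite wt_nseq_false => wt1.
by rewrite -wt1 in wtb.
Qed.

End WeightOne.

(** * Exactness of the polynomial Koszul complex below top degree *)

Section PolynomialKoszul.
Variables (k : closedFieldType) (n r : nat).
Local Notation S := {mpoly k[n]}.
Implicit Types (w z : seq bool -> 'rV[S]_r) (v : 'rV[S]_r).

Definition vars (s : seq 'I_n) : seq S := [seq 'X_i | i <- s].

Fixpoint rhos (s : seq 'I_n) v := if s is i :: s' then rhos s' (map_mx (rho i) v) else v.

Lemma mcoeff_rhos s v j m :
  (rhos s v 0 j)@_m = if all (fun i => m i == 0%N) s then (v 0 j)@_m else 0.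
Proof.
elim: s v => [|i s IH] v //=; rewrite IH mxE mcoeff_rho.
by case: (m i == 0%N); rewrite ?if_same.
Qed.

Lemma rhos_enum v j : rhos (enum 'I_n) v 0 j = ((v 0 j)@_0%MM)%:MP.
Proof.
apply/mpolyP => m; rewrite mcoeff_rhos mcoeffC; have [->|m0] := eqVneq m 0%MM.
  by rewrite mulr1 ifT //; apply/allP => i _; rewrite mnm0E.
rewrite mulr0 ifN //; apply: contraNN m0 => /allP m0; apply/eqP/mnmP => i.
by rewrite mnm0E; apply/eqP/m0; rewrite mem_enum.
Qed.

(** Induction along the mapping cone. The cocycle condition says that x_i times the [false] part is
    the differential of the [true] part. Setting x_i to zero turns the [true] part into a cocycle
    for the remaining variables, and applying [quo i] exhibits the [false] part as a differential.
    What survives is the top value modulo all the variables. *)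
Lemma kd_exact_vars s w : uniq s -> (forall b, size b = size s -> kd (vars s) w b = 0) ->
  exists z, forall b, size b = size s ->
    w b = kd (vars s) z b + (if all id b then rhos s (w b) else 0).
Proof.
elim: s w => [|i s IH] w /=.
  by move=> _ _; exists (fun=> 0) => -[|//] _; rewrite add0r.
move=> /andP[nis us] cocycle.
have size_vars t : size (vars t) = size t by rewrite size_map.
have eqw b : size b = size s -> 'X_i *: w (false :: b) = kd (vars s) (fun c => w (true :: c)) b.
  move=> szb; have /eqP := cocycle (true :: b) (congr1 succn szb).
  by rewrite subr_eq0 => /eqP.
have scal (h : {linear S -> S}) : (forall j f, i != j -> h ('X_j * f) = 'X_j * h f) ->
    forall b, map_mx h (kd (vars s) (fun c => w (true :: c)) b) =
      kd (vars s) (fun c => map_mx h (w (true :: c))) b.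
  move=> hX b; rewrite -[vars s in RHS]map_id.
  apply: (kd_morph (f := map_mx h : {additive 'rV[S]_r -> 'rV[S]_r}) (g := id)) => _ m /mapP[j js ->].
  apply/matrixP => i1 j1; rewrite !mxE; apply: hX.
  by apply: contraNneq nis => ->.
have [|z' hz'] := IH (fun b => map_mx (rho i) (w (true :: b))) us.
  move=> b szb; rewrite -scal; last by move=> j f ne; apply: rhoXM.
  by rewrite -eqw //; apply/matrixP => i1 j1; rewrite !mxE; apply: rhoX.
(* The [true] part is x_i times its quotient plus its remainder; the sign of [z'] compensates the
   sign in the cone differential. *)
exists (fun b => match b with
  | false :: c => map_mx (quo i) (w (true :: c)) | true :: c => - z' c | _ => 0 end).
move=> [|[] b] //= [szb].
  have := kd_lin (vars s) (-1) z' (fun=> 0) b; rewrite kd0 addr0 scaleN1r => kdN.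
  rewrite (kd_eq (w' := fun c => -1 *: z' c + 0)) ?size_vars //; last first.
    by move=> c _; rewrite scaleN1r addr0.
  rewrite kdN opprK -addrA -(hz' b szb); apply/matrixP => i1 j1; rewrite !mxE.
  by rewrite {1}(rho_quo i (w _ _ _)) addrC.
rewrite addr0 -scal; last by move=> j f ne; apply: quoXM.
by rewrite -eqw //; apply/matrixP => i1 j1; rewrite !mxE; apply: (esym (quoX _ _)).
Qed.

(** Below top weight the correction term of [kd_exact_vars] vanishes because [w] does at the top. *)
Lemma kd_exact p w : (p.+1 < n)%N ->
  (forall b, wt b != p.+1 -> w b = 0) ->
  (forall b, size b = n -> kd (vars (enum 'I_n)) w b = 0) ->
  exists z, (forall b, wt b != p -> z b = 0) /\
    forall b, size b = n -> w b = kd (vars (enum 'I_n)) z b.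
Proof.
move=> lt_pn w0 cocycle; have sz : size (vars (enum 'I_n)) = n by rewrite size_map size_enum_ord.
have [|z hz] := kd_exact_vars (enum_uniq 'I_n) (w := w).
  by move=> b; rewrite size_enum_ord; apply: cocycle.
have {}hz b : size b = n -> w b = kd (vars (enum 'I_n)) z b.
  move=> szb; rewrite {1}hz ?size_enum_ord //; case: ifP => [allb|_]; last by rewrite addr0.
  have wtb : wt b = n by apply/eqP; rewrite -szb -all_count.
  rewrite w0 ?wtb; last by rewrite neq_ltn lt_pn orbT.
  suff -> : rhos (enum 'I_n) 0 = 0 by rewrite addr0.
  by apply/rowP => j; rewrite rhos_enum !mxE mcoeff0.
exists (trunc p z); split=> [b|b szb]; first by rewrite /trunc => /negPf->.
by rewrite kd_trunc ?sz // /trunc; case: eqP => [_|/eqP/w0->//]; apply: hz.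
Qed.

(** In top weight every cochain is closed, and the correction term consists of the constant terms,
    which are zero here. *)
Lemma kd_exact_top w : (0 < n)%N -> (forall b, wt b != n -> w b = 0) ->
  (forall j, (w (nseq n true) 0 j)@_0%MM = 0) ->
  exists z, (forall b, wt b != n.-1 -> z b = 0) /\
    forall b, size b = n -> w b = kd (vars (enum 'I_n)) z b.
Proof.
move=> n0 w0 const0; have sz : size (vars (enum 'I_n)) = n by rewrite size_map size_enum_ord.
have [|z hz] := kd_exact_vars (enum_uniq 'I_n) (w := w).
  move=> b; rewrite size_enum_ord => szb; rewrite -[RHS](kd0 _ (vars (enum 'I_n)) b).
  apply: kd_ext; rewrite ?sz // => c szc wtc; apply: w0; apply: contraTneq (count_size id b).
  by rewrite szb -wtc => ->; rewrite ltnn.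
have {}hz b : size b = n -> w b = kd (vars (enum 'I_n)) z b.
  move=> szb; rewrite {1}hz ?size_enum_ord //; case: ifP => [allb|_]; last by rewrite addr0.
  suff -> : rhos (enum 'I_n) (w b) = 0 by rewrite addr0.
  have -> : b = nseq n true by rewrite -szb; elim: (b) allb => [|[] c IHc] //= /IHc {1}->.
  by apply/rowP => j; rewrite rhos_enum const0 mxE mpolyC0.
exists (trunc n.-1 z); split=> [b|b szb]; first by rewrite /trunc => /negPf->.
by rewrite kd_trunc ?sz // prednK // /trunc; case: eqP => [_|/eqP/w0->//]; apply: hz.
Qed.

End PolynomialKoszul.

(** * Homogeneous elements of graded free modules *)

Section GradedRows.
Variables (k : closedFieldType) (N : nat).
Local Notation S := {mpoly k[N]}.

(* Homogeneous elements of degree a of the direct sum of the S(- s j). *)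
Definition hzv r (s : 'I_r -> int) (a : int) (v : 'rV[S]_r) := forall j, hz (a - s j) (v 0 j).

Definition pzv r (s : 'I_r -> int) (a : int) (v : 'rV[S]_r) : 'rV[S]_r :=
  \row_j pz (a - s j) (v 0 j).

Lemma hzv_pzv r (s : 'I_r -> int) a v : hzv s a (pzv s a v).
Proof. by move=> j; rewrite mxE; apply: hz_pz. Qed.

Lemma pzv_id r (s : 'I_r -> int) a v : hzv s a v -> pzv s a v = v.
Proof. by move=> hv; apply/rowP => j; rewrite mxE pz_id. Qed.

Lemma hzvD r (s : 'I_r -> int) a v w (x : S) :
  hz 0 x -> hzv s a v -> hzv s a w -> hzv s a (x *: v + w).
Proof.
move=> hx hv hw j; rewrite !mxE; apply: hzD => //.
by rewrite -[a - _]add0r; apply: hzM.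
Qed.

Lemma pzvB r (s : 'I_r -> int) a v w : pzv s a (v - w) = pzv s a v - pzv s a w.
Proof. by apply/rowP => j; rewrite !mxE linearB. Qed.

Lemma pzv_mulmx r r' (s : 'I_r -> int) (s' : 'I_r' -> int) (A : 'M[S]_(r, r')) a v :
  (forall i j, hz (s i - s' j) (A i j)) -> pzv s' a (v *m A) = pzv s a v *m A.
Proof.
move=> hA; apply/rowP => j; rewrite !mxE linear_sum; apply: eq_bigr => i _ /=.
have -> : a - s' j = (s i - s' j) + (a - s i) by ring.
by rewrite !mxE mulrC pzM // mulrC.
Qed.

Lemma kd_pzv r (s : 'I_r -> int) a (l : seq 'I_N) (w : seq bool -> 'rV[S]_r) b :
  pzv s (1 + a) (kd (vars k l) w b) = kd (vars k l) (fun c => pzv s a (w c)) b.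
Proof.
have pzv0 c : pzv s c 0 = 0 by apply/rowP => j; rewrite !mxE linear0.
elim: l w b => [|i l IH] w [|[] b] /=; rewrite ?pzv0 ?pzvB ?IH //.
congr (_ - _); apply/rowP => j; rewrite !mxE -addrA pzM //.
exact: hzX.
Qed.

End GradedRows.

(** * The socle of the first cohomology module *)

Section Socle.
Variables (k : closedFieldType) (n : nat).
Local Notation N := n.+1.
Local Notation S := {mpoly k[N]}.
Local Notation K := {fraction {mpoly k[N]}}.
Local Notation X i := ('X_i : S).
Local Notation xs := (vars k (enum 'I_N)).
Local Notation xsF := ([seq (X p)%:F | p <- enum 'I_N] : seq K).
Variable I : S -> Prop.
Hypotheses (hI : is_ideal (fun=> True) I) (satI : saturated I).
Implicit Types (m : int) (c : 'M[K]_N) (u : 'I_N -> 'I_N -> K) (W y : seq bool -> S).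

(* u p is a primitive of x_p c; its Koszul differential W is the same on every chart. *)
Definition koszul_of m c W := exists u,
  [/\ forall p i, sections I (X i) (hdeg (m + 1)) (u p i),
      forall p i j, (X p)%:F * c i j = u p j - u p i
    & forall i b, size b = N -> kd xsF (coch1 (fun p => u p i : K^o)) b = (W b)%:F].

Definition koszul_cocycle m W :=
  [/\ forall b, I (W b), forall b, hz (m + 2) (W b), forall b, wt b != 2%N -> W b = 0
    & forall b, size b = N -> kd xs (W : seq bool -> S^o) b = 0].

Lemma kd_tofrac y b :
  (kd xs (y : seq bool -> S^o) b)%:F = kd xsF (fun d => (y d)%:F : K^o) b.
Proof.
have := @kd_morph _ _ S^o K^o (@FracField.tofrac _) (@FracField.tofrac S) xs y b.
have -> : map (@FracField.tofrac S) xs = xsF by rewrite /vars -map_comp.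
move=> morph; apply: morph => x z _; exact: tofracM.
Qed.

(** On each chart, subtracting [y] from the cochain (u p i)_p gives a Koszul 1-cocycle over the
    field [K], where x_0 is invertible; so it has the form (x_p t_i)_p, and the differences of the
    t_i recover [c]. *)
Lemma koszul_of_lift m c W y : koszul_of m c W ->
  (forall b, size b = N -> W b = kd xs (y : seq bool -> S^o) b) ->
  exists (u : 'I_N -> 'I_N -> K) (t : 'I_N -> K),
    [/\ forall p i, sections I (X i) (hdeg (m + 1)) (u p i),
        forall p i, u p i = (y (bit (enum 'I_N) p))%:F + (X p)%:F * t i
      & forall i j, c i j = t j - t i].
Proof.
move=> [u [hu cu uW]] yW.
have /fin_all_exists[t ht] : forall i, exists t, forall p,
    u p i = (y (bit (enum 'I_N) p))%:F + (X p)%:F * t.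
  move=> i; pose v b : K^o := coch1 (fun p => u p i : K^o) b - (y b)%:F.
  have szx : size xsF = N by rewrite size_map size_enum_ord.
  have [z hz] : exists z, forall b, size b = N -> v b = kd xsF z b.
    have def_xs : xsF = (X ord0)%:F :: [seq (X p)%:F | p <- map (lift ord0) (enum 'I_n)].
      by rewrite enum_ordSl.
    have := @kd_exact_field K K^o _ [seq (X p)%:F | p <- map (lift ord0) (enum 'I_n)] v
      (varF_neq0 k ord0).
    rewrite -def_xs 2!size_map size_enum_ord; apply=> b szb.
    by rewrite kdB ?szx // uW // yW // kd_tofrac subrr.
  exists (z (nseq N false)) => p.
  have := hz (bit (enum 'I_N) p); rewrite size_bit size_enum_ord => /(_ erefl).
  by rewrite /v coch1_bit kd_bit => /eqP; rewrite subr_eq addrC => /eqP.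
exists u, t; split=> // i j; apply: (mulfI (varF_neq0 k ord0)).
by rewrite cu !ht opprD addrACA subrr add0r mulrBr.
Qed.

(** Since x_i is inverted on its own chart and x_i t_i = u_ii - y_i has numerator in [I], the t_i
    form a primitive with values in the sheaf of [I]. *)
Lemma koszul_of_B1 m c W y : koszul_of m c W -> (forall b, I (y b)) ->
  (forall b, size b = N -> W b = kd xs (y : seq bool -> S^o) b) -> B1 I anydeg c.
Proof.
move=> cW Iy yW; have [u [t [hu ut ct]]] := koszul_of_lift cW yW.
exists t; split=> // i; split=> //.
have -> : t i = (u i i - (y (bit (enum 'I_N) i))%:F) / (X i)%:F.
  by rewrite ut [_%:F + _]addrC addrK mulrC mulKf // varF_neq0.
apply: sec_div; apply: secB => //; first by rewrite varX_neq0.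
  by case: (hu i i).
exact: sec_poly.
Qed.

Hypothesis n_gt0 : (0 < n)%N.

Lemma socle_koszul m c : soc_cocycle I m c -> exists W, koszul_of m c W /\ koszul_cocycle m W.
Proof.
move=> [[hc cc] socc]; have szx : size xsF = N by rewrite size_map size_enum_ord.
have /fin_all_exists[u hu] : forall p, exists u : 'I_N -> K,
    (forall i, sections I (X i) (hdeg (m + 1)) (u i)) /\
    (forall i j, (X p)%:F * c i j = u j - u i).
  by move=> p; have [u [hu cu]] := socc p; exists u; split=> // i j; rewrite -cu mxE.
pose U i := coch1 (fun p => u p i : K^o).
(* On two charts the primitives differ by x_p c_ji, that is by the Koszul differential of the
   0-cochain c_ji, which [kdK] kills. *)
have Uindep i j b : size b = N -> kd xsF (U i) b = kd xsF (U j) b.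
  move=> szb; apply/eqP; rewrite -subr_eq0 -kdB ?szx //; apply/eqP.
  rewrite -(kdK (M := K^o) (xs := xsF) (coch0 N (c j i : K^o)) (b := b)) ?szx //.
  apply: kd_eq; rewrite ?szx // => d szd; rewrite kd_coch0 //.
  apply: (eq_coch1 (w := fun d => U i d - U j d)) => // [p|d' wtd]; last by rewrite /U !coch1_wt // subrr.
  by rewrite /U !coch1_bit; have [_ <-] := hu p.
have degU i b : hdeg (m + 2) (kd xsF (U i) b).
  apply: (@kd_ind _ _ (fun z : K^o => hdeg (m + 1) z) (hdeg (m + 2))).
  - exact: hdeg0.
  - exact: hdegB.
  - move=> x z /mapP[p _ ->] hz; rewrite (_ : m + 2 = 1 + (m + 1)); last by rewrite addrCA.
    by apply: hdegM => //; apply: hdegX.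
  - move=> d; apply: big_ind => [|y z|p _]; [exact: hdeg0|exact: hdegD|].
    by case: eqP => _; [case: (hu p) => + _ => /(_ i)[]|exact: hdeg0].
have secU i b : sec I (X i) (kd xsF (U i) b).
  have Xi0 := varX_neq0 k i.
  apply: (@kd_ind _ _ (fun z : K^o => sec I (X i) z) (sec I (X i))).
  - exact: sec0.
  - by move=> y z; apply: secB.
  - by move=> x z /mapP[p _ ->] hz; apply: secMp.
  - move=> d; apply: big_ind => [|y z|p _]; [exact: sec0|exact: secD|].
    by case: eqP => _; [case: (hu p) => + _ => /(_ i)[]|exact: sec0].
have exW b : exists f, I f /\ (size b = N -> kd xsF (U ord0) b = f%:F) /\
    (size b != N -> f = 0).
  (* Lists of the wrong length get the value 0, so that the conditions imposed on every [b] hold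
     there too. *)
  have [szb|szb] := eqVneq (size b) N; last by exists 0; split; [exact: ideal0|split=> // szb0; move: szb; rewrite szb0 eqxx].
  have [|f [If def_f]] := glue n_gt0 hI satI (z := kd xsF (U ord0) b).
    by move=> i; rewrite (Uindep ord0 i).
  by exists f.
pose W b := if wt b == 2%N then proj1_sig (constructive_indefinite_description _ (exW b)) else 0.
have WP b : I (W b) /\ (size b = N -> kd xsF (U ord0) b = (W b)%:F) /\ (size b != N -> W b = 0).
  rewrite /W; case: eqP => wtb; first by case: constructive_indefinite_description.
  split; [exact: ideal0|split=> // szb].
  rewrite tofrac0; transitivity (kd xsF (fun=> 0 : K^o) b); last exact: kd0.
  apply: kd_ext; rewrite ?szx // => d szd wtd.
  by rewrite /U coch1_wt //; apply/eqP; lia.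
exists W; split.
  exists u; split=> [p i|p i j|i b szb].
  - by have [h1 _] := hu p; apply: h1.
  - by have [_ h2] := hu p; apply: h2.
  by case: (WP b) => _ [<- // _]; apply: (Uindep i ord0).
split=> [b|b|b /negPf|b szb]; first by case: (WP b).
- have [_ [h1 h2]] := WP b; have [szb|/h2->] := eqVneq (size b) N; last exact: hz0.
  by apply/hdeg_poly; rewrite -h1 //; apply: degU.
- by rewrite /W => ->.
apply: tofrac_inj; rewrite kd_tofrac tofrac0.
transitivity (kd xsF (kd xsF (U ord0)) b); last by apply: (@kdK _ K^o xsF (U ord0) b); rewrite szx.
apply: (@kd_eq _ K^o xsF) => [|d szd]; first by rewrite szx.
by rewrite szx in szd; case: (WP d) => _ [-> //].
Qed.

Lemma koszul_of_lc x m c c' W W' : koszul_of m c W -> koszul_of m c' W' ->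
  koszul_of m (lc x c c') (fun b => x%:MP * W b + W' b).
Proof.
have szx : size xsF = N by rewrite size_map size_enum_ord.
move=> [u [hu cu uW]] [u' [hu' cu' uW']].
exists (fun p i => (x%:MP : S)%:F * u p i + u' p i); split=> [p i|p i j|i b szb].
- have [su du] := hu p i; have [su' du'] := hu' p i.
  split; first by apply: secD; rewrite ?varX_neq0 //; apply: secMp.
  by case: (lclosed_hdeg k n (m + 1)) => _; apply.
- by rewrite !mxE mulrDr mulrCA cu cu' mulrBr opprD addrACA.
- rewrite tofracD tofracM -(uW i b szb) -(uW' i b szb).
  transitivity (kd xsF (fun d => (x%:MP : S)%:F *: coch1 (fun p => u p i : K^o) d +
    coch1 (fun p => u' p i : K^o) d) b); last exact: (@kd_lin _ K^o).
  by apply: (@kd_eq _ K^o xsF) => [|d _]; [rewrite szx|rewrite -(@coch1_lin _ K^o)].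
Qed.

Lemma koszul_cocycle_lc x m W W' :
  koszul_cocycle m W -> koszul_cocycle m W' ->
  koszul_cocycle m (fun b => x%:MP * W b + W' b).
Proof.
have szx : size xs = N by rewrite size_map size_enum_ord.
move=> [IW hW wW kW] [IW' hW' wW' kW']; split=> b.
- by apply: idealD => //; apply: ideal_mull.
- by apply: hzD => //; rewrite -[m + 2]add0r; apply: hzM => //; apply: hzC.
- by move=> wtb; rewrite wW // wW' // mulr0 addr0.
- move=> szb; have := kd_lin xs (x%:MP : S) (W : seq bool -> S^o) W' b.
  by rewrite kW // kW' // scaler0 addr0.
Qed.

End Socle.

(** * Chasing Koszul classes through the free resolution *)

Section Resolution.
Variables (k : closedFieldType) (n : nat).
Local Notation N := n.+1.
Local Notation S := {mpoly k[N]}.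
Local Notation xs := (vars k (enum 'I_N)).
Variables (I : S -> Prop) (F : free_complex k N) (m : int).
Hypotheses (n_gt0 : (0 < n)%N) (homI : homog_ideal I) (satI : saturated I).
Hypothesis resF : minimal_resolution n I F.

Let hI : is_ideal (fun=> True) I. Proof. by case: homI. Qed.

Let szx : size xs = N. Proof. by rewrite size_map size_enum_ord. Qed.

Lemma kd_mulmx r r' (A : 'M[S]_(r, r')) (w : seq bool -> 'rV[S]_r) b :
  kd xs w b *m A = kd xs (fun c => w c *m A) b.
Proof.
rewrite -[xs in RHS]map_id.
apply: (kd_morph (f := mulmxr A : {additive 'rV[S]_r -> 'rV[S]_r'}) (g := id)) => x v _.
by rewrite /= -scalemxAl.
Qed.

Lemma diff_hz l i j : hz (shift F l.+1 i - shift F l j) (diff F l i j).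
Proof.
have [_ _ homF _ _] := resF; have [->|nz] := eqVneq (diff F l i j) 0; first exact: hz0.
by have [d [<- /hz_homog]] := homF l i j nz.
Qed.

Definition im l (v : 'rV[S]_(rk F l)) := exists w, v = w *m diff F l.

(** Koszul cocycles with values in the image of F_(l+1) in F_l, which is [I] for l = 0. The degree
    grows with [p] because the Koszul differential multiplies by a variable. *)
Definition cocycle p l (w : seq bool -> 'rV[S]_(rk F l)) :=
  [/\ forall b, im (w b), forall b, wt b != p -> w b = 0,
      forall b, hzv (shift F l) (m + p%:Z) (w b)
    & forall b, size b = N -> kd xs w b = 0].

Definition coboundary l (w : seq bool -> 'rV[S]_(rk F l)) :=
  exists y : seq bool -> 'rV[S]_(rk F l),
    (forall b, im (y b)) /\ forall b, size b = N -> w b = kd xs y b.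

Definition lin_cochain r (x : k) (w w' : seq bool -> 'rV[S]_r) b := x%:MP *: w b + w' b.

Lemma lin_mulmx r r' (x : S) (v w : 'rV[S]_r) (A : 'M[S]_(r, r')) :
  (x *: v + w) *m A = x *: (v *m A) + w *m A.
Proof. by rewrite mulmxDl -scalemxAl. Qed.

Lemma cocycle_lin p l x (w w' : seq bool -> 'rV[S]_(rk F l)) :
  cocycle p w -> cocycle p w' -> cocycle p (lin_cochain x w w').
Proof.
move=> [imw w0 hw kw] [imw' w'0 hw' kw']; split=> b.
- have [v wv] := imw b; have [v' wv'] := imw' b.
  by exists (x%:MP *: v + v'); rewrite lin_mulmx -wv -wv'.
- by move=> wtb; rewrite /lin_cochain w0 // w'0 // scaler0 addr0.
- by apply: hzvD => //; apply: hzC.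
- by move=> szb; rewrite kd_lin kw // kw' // scaler0 addr0.
Qed.

Definition tops l := #|[set j : 'I_(rk F l) | shift F l j == m + N%:Z]|.

(** A cochain of weight [N] is its value at the all-true vector; lift that value to [v] in F_n. By
    degree only the generators counted by [tops] can have a nonzero constant coefficient in [v]. If
    these vanish, [kd_exact_top] bounds [v] in F_n, and [diff] carries the primitive over to [w]. *)
Lemma chase_top l : l.+1 = n ->
  le_dim (@lin_cochain (rk F l)) (@cocycle N l) (@coboundary l) (tops l.+1).
Proof.
move=> eq_ln; pose top := nseq N true.
have wt_top : wt top = N by rewrite /top; elim: N => //= q ->.
pose A := [set j : 'I_(rk F l.+1) | shift F l.+1 j == m + N%:Z].
exists (fun w t => exists v : 'rV[S]_(rk F l.+1), [/\ w top = v *m diff F l,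
  hzv (shift F l.+1) (m + N%:Z) v & forall j : 'I_#|A|, t 0 j = (v 0 (enum_val j))@_0%MM]).
split=> [w [imw _ hw _]|x w w' t t' [v [wv hv tv]] [v' [wv' hv' tv']]|w [_ w0 _ _] [v [wv hv tv]]].
- have [v wv] := imw top.
  exists (\row_j ((pzv (shift F l.+1) (m + N%:Z) v) 0 (enum_val j))@_0%MM).
  exists (pzv (shift F l.+1) (m + N%:Z) v); split=> [||j]; last by rewrite mxE.
    rewrite -(@pzv_mulmx _ _ _ _ _ (shift F l)); last exact: diff_hz.
    by rewrite -wv pzv_id.
  exact: hzv_pzv.
- exists (x%:MP *: v + v'); split=> [||j].
  + by rewrite /lin_cochain lin_mulmx wv wv'.
  + by apply: hzvD => //; apply: hzC.
  + by rewrite !mxE tv tv' mcoeffD mcoeffCM.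
have const0 j : (v 0 j)@_0%MM = 0.
  have [jA|jA] := boolP (j \in A).
    by have := tv (enum_rank_in jA j); rewrite mxE enum_rankK_in.
  apply/eqP; apply: contraNT jA => /(hv j) /eqP; rewrite mdeg0 eq_sym subr_eq0 inE.
  by rewrite eq_sym.
pose V b : 'rV[S]_(rk F l.+1) := if b == top then v else 0.
have [|||z [_ Vz]] := @kd_exact_top k N _ V.
- by [].
- by move=> b; rewrite /V; case: (b =P top) => // ->; rewrite wt_top eqxx.
- by move=> j; rewrite /V eqxx.
exists (fun b => z b *m diff F l); split=> [b|b szb]; first by exists (z b).
rewrite -kd_mulmx -Vz // /V; case: eqP => [->//|ntop]; rewrite mul0mx w0 //.
apply: contra_notN ntop => /eqP wtb.
have : all id b by rewrite all_count wtb szb.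
by rewrite /top -szb; elim: (b) => [|[] c IHc] //= /IHc {1}->.
Qed.

(** Dimension shifting: lift [w] to [v] in F_(l+1); the Koszul differential of [v] lies in the image
    of F_(l+2) by exactness of [F]. This connecting relation is injective on classes, because the
    Koszul cohomology of F_(l+1) vanishes in weights between 0 and [N]. *)
Lemma chase q : forall l p, (q + l.+1 = n)%N -> (p + q = N)%N -> (0 < p)%N ->
  le_dim (@lin_cochain (rk F l)) (@cocycle p l) (@coboundary l) (tops n).
Proof.
have [_ _ _ _ [_ exactF]] := resF.
elim: q => [|q IH] l p eq_n eq_N p0.
  have <- : tops l.+1 = tops n by congr tops.
  by rewrite -[p]addn0 eq_N; apply: chase_top.
have {}IH := IH l.+1 p.+1; rewrite addSnnS in eq_n; rewrite -addSnnS in eq_N.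
have {}IH := IH eq_n eq_N (ltn0Sn _).
pose psi w w' := exists v : seq bool -> 'rV[S]_(rk F l.+1),
  [/\ forall b, w b = v b *m diff F l, forall b, wt b != p -> v b = 0,
      forall b, size b = N -> w' b = kd xs v b & cocycle p.+1 w'].
apply: (le_dim_pull (psi := psi) IH).
- move=> w [imw w0 hw kw].
  pose v0 b := proj1_sig (constructive_indefinite_description _ (imw b)).
  have v0P b : w b = v0 b *m diff F l.
    exact: (proj2_sig (constructive_indefinite_description _ (imw b))).
  (* The lift is cut down to weight [p] and degree m + p; it still lifts [w], which has that weight
     and degree, as [diff] is homogeneous. *)
  pose v := trunc p (fun b => pzv (shift F l.+1) (m + p%:Z) (v0 b)).
  have vP b : w b = v b *m diff F l.
    rewrite /v /trunc; case: eqP => [_|/eqP wtb]; last by rewrite mul0mx w0.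
    rewrite -(@pzv_mulmx _ _ _ _ _ (shift F l)); last exact: diff_hz.
    by rewrite -v0P pzv_id.
  have hv b : hzv (shift F l.+1) (m + p%:Z) (v b).
    rewrite /v /trunc; case: eqP => _; first exact: hzv_pzv.
    by move=> j; rewrite mxE; apply: hz0.
  have v_wt b : wt b != p -> v b = 0 by rewrite /v /trunc => /negPf->.
  have kv_wt b : size b = N -> wt b != p.+1 -> kd xs v b = 0.
    by move=> szb wtb; rewrite kd_trunc ?szx // /trunc (negPf wtb).
  have hkv b : size b = N -> hzv (shift F l.+1) (m + p.+1%:Z) (kd xs v b).
    move=> szb; have -> : m + p.+1%:Z = 1 + (m + p%:Z) by lia.
    suff -> : kd xs v b = pzv (shift F l.+1) (1 + (m + p%:Z)) (kd xs v b).
      exact: hzv_pzv.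
    rewrite kd_pzv; apply: kd_eq; rewrite ?szx // => c _.
    by rewrite pzv_id.
  exists (fun b => if size b == N then kd xs v b else 0), v; split=> // [b szb|].
    by rewrite szb eqxx.
  split=> [b|b wtb|b|b szb].
  + case: eqP => [szb|_]; last by exists 0; rewrite mul0mx.
    apply/exactF; rewrite kd_mulmx -(kw b szb); apply: kd_eq; rewrite ?szx // => c _.
  + by case: (size b =P N) => [szb|//]; apply: kv_wt.
  + by case: eqP => [/hkv//|_] j; rewrite mxE; apply: hz0.
  + rewrite -[RHS](kdK v (xs := xs) (b := b)) ?szx //; apply: kd_eq; rewrite ?szx //.
    by move=> c ->; rewrite eqxx.
- by move=> w w' [v []].
- move=> x w1 w2 w1' w2' [v1 [wv1 v10 kv1 c1]] [v2 [wv2 v20 kv2 c2]].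
  exists (fun b => x%:MP *: v1 b + v2 b); split=> [b|b wtb|b szb|].
  + by rewrite lin_mulmx -wv1 -wv2.
  + by rewrite v10 // v20 // scaler0 addr0.
  + by rewrite kd_lin -kv1 // -kv2.
  + exact: cocycle_lin.
move=> w w' [imw w0 _ _] [v [wv v0 kv [_ w'0 _ _]]] [y [imy w'y]].
(* [v] and [y] have the same Koszul differential, so they differ by that of some [z]. As [diff]
   kills [y], the image of [z] is a primitive of [w]. *)
have [|||z [_ vz]] := @kd_exact k N _ p.-1 (fun b => v b - trunc p y b).
- by rewrite prednK // -eq_N; lia.
- move=> b; rewrite prednK // => wtb; rewrite v0 // /trunc (negPf wtb) subrr //.
- move=> b szb; rewrite kdB ?szx // kd_trunc ?szx // -kv // /trunc -w'y //.
  by case: eqP => [_|/eqP/w'0->]; rewrite subrr.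
exists (fun b => z b *m diff F l); split=> [b|b szb]; first by exists (z b).
rewrite wv -kd_mulmx -vz // mulmxBl [X in _ - X](_ : _ = 0) ?subr0 //.
rewrite /trunc; case: eqP => _; last by rewrite mul0mx.
by apply/exactF; apply: imy.
Qed.

Theorem soc_le_dim : le_dim (@lc k n) (soc_cocycle I m) (B1 I (hdeg m)) (tops n).
Proof.
have [[rk0 shift0] _ _ _ [genF exactF]] := resF.
have [j0 j0P] : exists j0 : 'I_(rk F 0), forall j, j = j0.
  have lt0 : (0 < rk F 0)%N by rewrite rk0.
  exists (Ordinal lt0) => j; apply: val_inj => /=; have := ltn_ord j; lia.
(* The chase starts in weight 2 at F_0, where rank one identifies row vectors with polynomials, and
   after n - 1 shifts reaches weight [N] at F_(n-1). *)
have eq_N : (2 + n.-1 = N)%N by lia.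
have eq_n : (n.-1 + 1 = n)%N by lia.
pose psi c w := exists W, [/\ koszul_of I m c W, koszul_cocycle I m W & forall b, w b = const_mx (W b) :> 'rV_(rk F 0)].
have imP f : im (const_mx f : 'rV_(rk F 0)) <-> I f.
  by split=> [[v vf]|/genF[v vf]]; [apply/genF; exists v|exists v].
have kd_const (y : seq bool -> S) b :
    const_mx (kd xs (y : seq bool -> S^o) b) = kd xs (fun c => const_mx (y c) : 'rV[S]_(rk F 0)) b.
  rewrite -[xs in RHS]map_id.
  apply: (kd_morph (M := S^o) (f := const_mx : {additive S^o -> 'rV[S]_(rk F 0)}) (g := id)).
  by move=> x y' _; apply/rowP => j; rewrite !mxE.
apply: (le_dim_pull (psi := psi) (chase eq_n eq_N isT)).
- move=> c /(socle_koszul hI satI n_gt0)[W [cW WW]].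
  by exists (fun b => const_mx (W b)), W.
- move=> c w [W [_ [IW hW W0 kW] wW]]; split=> [b|b wtb|b j|b szb].
  + by rewrite wW; apply/imP.
  + by rewrite wW W0 //; apply/rowP => j; rewrite !mxE.
  + by rewrite wW mxE shift0 subr0; apply: hW.
  + rewrite -[LHS](_ : const_mx (kd xs (W : seq bool -> S^o) b) = _).
      by rewrite kW //; apply/rowP => j; rewrite !mxE.
    by rewrite kd_const; apply: kd_eq; rewrite ?szx.
- move=> x c1 c2 w1 w2 [W1 [k1 kW1 wW1]] [W2 [k2 kW2 wW2]].
  exists (fun b => x%:MP * W1 b + W2 b); split=> [||b].
  + exact: koszul_of_lc.
  + exact: koszul_cocycle_lc.
  + by rewrite /lin_cochain wW1 wW2; apply/rowP => j; rewrite !mxE.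
move=> c w [[hc _] _] [W [cW WW wW]] [y [imy wy]].
apply: (B1_homog homI) => [i j|]; first by case: (hc i j).
have y_const b : y b = const_mx (y b 0 j0) by apply/rowP => j; rewrite (j0P j) mxE.
apply: (koszul_of_B1 hI cW (y := fun b => y b 0 j0)) => [b|b szb].
  by apply/imP; rewrite -y_const.
have : const_mx (W b) = const_mx (kd xs (fun b => y b 0 j0 : S^o) b) :> 'rV_(rk F 0).
  by rewrite -wW wy // kd_const; apply: kd_eq; rewrite ?szx.
by move=> /rowP/(_ j0); rewrite !mxE.
Qed.

End Resolution.

(** * Hyperplane sections *)

Section Substitution.
Variable k : closedFieldType.

(** The substitution inside [hyperplane_section], for a matrix of any shape so that lifts back to
    the ambient space are covered as well. *)
Definition lsub p q (M : 'M[k]_(p, q)) : {mpoly k[p]} -> {mpoly k[q]} :=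
  comp_mpoly [tuple \sum_(j < q) M i j *: 'X_j | i < p].

HB.instance Definition _ p q (M : 'M[k]_(p, q)) := GRing.RMorphism.on (lsub M).

Lemma lsubC p q (M : 'M[k]_(p, q)) c : lsub M c%:MP = c%:MP.
Proof. exact: comp_mpolyC. Qed.

Lemma lsub0 p q (M : 'M[k]_(p, q)) : lsub M 0 = 0. Proof. exact: rmorph0. Qed.
Lemma lsubD p q (M : 'M[k]_(p, q)) : {morph lsub M : f g / f + g}. Proof. exact: rmorphD. Qed.
Lemma lsubB p q (M : 'M[k]_(p, q)) : {morph lsub M : f g / f - g}. Proof. exact: rmorphB. Qed.
Lemma lsubM p q (M : 'M[k]_(p, q)) : {morph lsub M : f g / f * g}. Proof. exact: rmorphM. Qed.
Lemma lsubXn p q (M : 'M[k]_(p, q)) e : {morph lsub M : f / f ^+ e}. Proof. exact: rmorphXn. Qed.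
Lemma lsub_sum p q (M : 'M[k]_(p, q)) T (s : seq T) P (G : T -> {mpoly k[p]}) :
  lsub M (\sum_(t <- s | P t) G t) = \sum_(t <- s | P t) lsub M (G t).
Proof. exact: rmorph_sum. Qed.
Lemma lsub_prod p q (M : 'M[k]_(p, q)) T (s : seq T) P (G : T -> {mpoly k[p]}) :
  lsub M (\prod_(t <- s | P t) G t) = \prod_(t <- s | P t) lsub M (G t).
Proof. exact: rmorph_prod. Qed.

Lemma lsubX p q (M : 'M[k]_(p, q)) i : lsub M 'X_i = lin_form (row i M).
Proof.
rewrite /lsub comp_mpolyXU -tnth_nth tnth_mktuple.
by apply: eq_bigr => j _; rewrite mxE.
Qed.

Lemma lsubZ p q (M : 'M[k]_(p, q)) c f : lsub M (c *: f) = c *: lsub M f.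
Proof. by rewrite -mul_mpolyC lsubM lsubC mul_mpolyC. Qed.

Lemma lsub_lin_form p q (M : 'M[k]_(p, q)) b : lsub M (lin_form b) = lin_form (b *m M).
Proof.
rewrite {1}/lin_form lsub_sum.
transitivity (\sum_i b 0 i *: lin_form (row i M)).
  by apply: eq_bigr => i _; rewrite lsubZ lsubX.
rewrite mulmx_sum_row; elim: (index_enum _) => [|i s IH].
  by rewrite !big_nil lin_form0.
by rewrite !big_cons -lin_formZ IH -lin_formD.
Qed.

Lemma mpoly_rect_ring p (P : {mpoly k[p]} -> Prop) :
  (forall c, P c%:MP) -> (forall i, P 'X_i) ->
  (forall f g, P f -> P g -> P (f + g)) -> (forall f g, P f -> P g -> P (f * g)) ->
  forall f, P f.
Proof.
move=> PC PX PD PM; elim/mpolyind => [|c m f _ _ Pf]; first by rewrite -mpolyC0.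
apply: (PD) => //; rewrite -mul_mpolyC; apply: (PM) => //.
rewrite mpolyXE_id; apply: (big_ind P) => [|x y|i _]; [by rewrite -mpolyC1|exact: PM|].
by elim: (m i) => [|e IH]; rewrite ?expr0 -?mpolyC1 // exprS; apply: PM.
Qed.

Lemma lsub_comp p q r (M : 'M[k]_(p, q)) (M' : 'M[k]_(q, r)) f :
  lsub M' (lsub M f) = lsub (M *m M') f.
Proof.
elim/mpoly_rect_ring: f => [c|i|f g Hf Hg|f g Hf Hg].
- by rewrite !lsubC.
- by rewrite !lsubX lsub_lin_form row_mul.
- by rewrite !lsubD Hf Hg.
- by rewrite !lsubM Hf Hg.
Qed.

Lemma lsub1 p f : lsub (1%:M : 'M[k]_p) f = f.
Proof.
elim/mpoly_rect_ring: f => [c|i|f g Hf Hg|f g Hf Hg].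
- by rewrite lsubC.
- by rewrite lsubX row1 lin_form_delta.
- by rewrite lsubD Hf Hg.
- by rewrite lsubM Hf Hg.
Qed.

Lemma hz_lin_form p (b : 'rV[k]_p) : hz 1 (lin_form b).
Proof. by apply/hz_homog/lin_form_homog. Qed.

Lemma hz_lsub p q (M : 'M[k]_(p, q)) a f : hz a f -> hz a (lsub M f).
Proof.
move=> hf; rewrite [f]mpolyE lsub_sum big_seq.
apply: (big_ind (hz a)) => [|x y|m]; [exact: hz0|exact: hzD|].
rewrite mcoeff_msupp => /hf <-; rewrite lsubZ; apply: hzZ.
rewrite mpolyXE_id lsub_prod mdegE.
apply: (big_ind2 (fun f (e : nat) => hz e f)) => [|f1 e1 f2 e2 h1 h2|i _].
- exact: hzC.
- by rewrite PoszD; apply: hzM.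
- by rewrite lsubXn lsubX -[Posz _]mulr1; apply/hzXn/hz_lin_form.
Qed.

Lemma pz_neq p a b (f : {mpoly k[p]}) : a != b -> hz a f -> pz b f = 0.
Proof.
move=> ne hf; apply/mpolyP => m; rewrite mcoeff_pz mcoeff0; case: eqP => // mb.
by apply/eqP; apply: contraNT ne => /hf <-; apply/eqP.
Qed.

Lemma pz_lsub p q (M : 'M[k]_(p, q)) a f : pz a (lsub M f) = lsub M (pz a f).
Proof.
have [B def_f] : exists B : nat, f = \sum_(d < B) pz d f by exists (msize f); apply: sum_pz.
have -> : pz a f = \sum_(d < B) pz a (pz d f) by rewrite {1}def_f linear_sum.
rewrite {1}def_f !lsub_sum linear_sum.
apply: eq_bigr => d _ /=; have [<-|ne] := eqVneq d%:Z a.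
  by rewrite !pz_id //; [exact: hz_pz|apply/hz_lsub/hz_pz].
rewrite (pz_neq ne (hz_pz d f)) lsub0.
by apply: (pz_neq ne); apply/hz_lsub/hz_pz.
Qed.

End Substitution.

Section Powers.
Variables (A : comNzRingType) (J : A -> Prop) (g : A).
Hypothesis hJ : is_ideal (fun=> True) J.

(** [h] lies in the radical of the ideal quotient J : g. Closure under linear combinations lets
    saturation be tested in any linear coordinates. *)
Definition kills_power (h : A) := exists e, J (h ^+ e * g).

Lemma kills_powerD h1 h2 : kills_power h1 -> kills_power h2 -> kills_power (h1 + h2).
Proof.
move=> [e1 J1] [e2 J2]; exists (e1 + e2)%N; rewrite exprDn mulr_suml.
apply: ideal_sum => // i _; rewrite mulrnAl -mulr_natl; apply: ideal_mull => //.
have [le|lt] := leqP e2 i.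
  have -> : h2 ^+ i = h2 ^+ (i - e2) * h2 ^+ e2 by rewrite -exprD subnK.
  rewrite (_ : _ * g = h1 ^+ (e1 + e2 - i) * h2 ^+ (i - e2) * (h2 ^+ e2 * g)); last by ring.
  exact: ideal_mull.
have -> : (e1 + e2 - i = e2 - i + e1)%N by lia.
rewrite exprD (_ : _ * g = h1 ^+ (e2 - i) * h2 ^+ i * (h1 ^+ e1 * g)); last by ring.
exact: ideal_mull.
Qed.

Lemma kills_powerM h1 h2 : kills_power h2 -> kills_power (h1 * h2).
Proof. by move=> [e Je]; exists e; rewrite exprMn -mulrA; apply: ideal_mull. Qed.

Lemma kills_power_sum (T : finType) (c h : T -> A) :
  (forall t, kills_power (h t)) -> kills_power (\sum_t c t * h t).
Proof.
move=> hh; apply: big_ind => [|x y|t _]; first by exists 1%N; rewrite mul0r; apply: ideal0.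
  exact: kills_powerD.
exact: kills_powerM.
Qed.

End Powers.

Lemma kills_power_lin_form (k : closedFieldType) p (J : {mpoly k[p]} -> Prop) g (b : 'rV[k]_p) :
  is_ideal (fun=> True) J -> (forall j, kills_power J g 'X_j) -> kills_power J g (lin_form b).
Proof.
move=> hJ hX; rewrite /lin_form.
under eq_bigr => i _ do rewrite -mul_mpolyC.
exact: kills_power_sum.
Qed.

Lemma subr_swap (T : comNzRingType) (x y v w : T) : x - y = v - w -> x - v = y - w.
Proof.
move=> eq_vw; apply: subr0_eq; rewrite (_ : _ - _ = (x - y) - (v - w)); last by ring.
by rewrite eq_vw subrr.
Qed.

Lemma frac_shift (F : fieldType) (x y g h z : F) :
  x != 0 -> g - y * (h / x - z) = (x * g - y * h) / x + y * z.
Proof. by move=> x0; field. Qed.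

Lemma mulrB_swap (T : comNzRingType) (b x y v w : T) :
  b * (x - y) = v - w -> b * y - w = b * x - v.
Proof.
move=> eq_vw; apply: subr0_eq; rewrite (_ : _ - _ = (v - w) - b * (x - y)); last by ring.
by rewrite eq_vw subrr.
Qed.

(** * The section by a regular hyperplane and the Buchsbaum property *)

Section Hyperplane.
Variables (k : closedFieldType) (n : nat).
Local Notation N := n.+2.
Local Notation S := {mpoly k[N]}.
Local Notation R := {mpoly k[n.+1]}.
Local Notation K := {fraction {mpoly k[N]}}.
Local Notation X i := ('X_i : S).
Local Notation Y j := ('X_j : R).
Variables (A : 'M[k]_(N, n.+1)) (a : 'rV[k]_N) (I : S -> Prop).
Hypotheses (rankA : \rank A = n.+1) (aA : a *m A = 0) (a_neq0 : a != 0).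
Local Notation L := (lin_form a).
Local Notation pi := (lsub A).

(** [B] is a left inverse of [A]. The rows of 1 - A B lie in the left kernel of [A], which by the
    rank of [A] is the line spanned by [a]. *)
Lemma splitting : exists (B : 'M[k]_(n.+1, N)) (e : 'cV[k]_N),
  B *m A = 1%:M /\ A *m B + e *m a = 1%:M.
Proof.
have /row_fullP[B BA] : row_full A by rewrite /row_full rankA.
exists B; suff /submxP[e def_e] : (1%:M - A *m B <= a)%MS.
  by exists e; split=> //; rewrite -def_e addrC subrK.
have sub_a : (a <= kermx A)%MS by apply/sub_kermxP.
have : (kermx A <= a)%MS.
  have [_ <-] := mxrank_leqif_sup sub_a.
  by rewrite mxrank_ker rankA subSS subSnn rank_rV a_neq0.
apply: submx_trans; apply/sub_kermxP.
by rewrite mulmxBl mul1mx -mulmxA BA mulmx1 subrr.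
Qed.

Lemma pi_L : pi L = 0.
Proof. by rewrite lsub_lin_form aA lin_form0. Qed.

Lemma pi_lift f (B : 'M[k]_(n.+1, N)) : B *m A = 1%:M -> pi (lsub B f) = f.
Proof. by move=> BA; rewrite lsub_comp BA lsub1. Qed.

Lemma pi_surj g a' : hz a' g -> exists f, hz a' f /\ g = pi f.
Proof.
have [B [_ [BA _]]] := splitting.
by move=> hg; exists (lsub B g); split; [exact: hz_lsub|rewrite pi_lift].
Qed.

(** Every [f] differs from the lift of its restriction by a multiple of [L]; this is checked on
    constants, variables (with cofactor [e i 0]), sums and products. *)
Lemma pi_ker f : pi f = 0 -> exists s, f = L * s.
Proof.
have [B [e [_ ABe]]] := splitting.
suff [s def_f] : exists s, f = lsub B (pi f) + L * s.
  by move=> f0; exists s; rewrite {1}def_f f0 lsub0 add0r.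
elim/mpoly_rect_ring: f => [c|i|f g [s Hf] [t Hg]|f g [s Hf] [t Hg]].
- by exists 0; rewrite !lsubC mulr0 addr0.
- exists (e i 0)%:MP; rewrite lsubX lsub_lin_form mulrC mul_mpolyC -lin_formZ -lin_formD.
  rewrite -row_mul (_ : e i 0 *: a = row i (e *m a)); last first.
    by apply/rowP => j; rewrite !mxE big_ord1.
  by rewrite -linearD /= ABe row1 lin_form_delta.
- by exists (s + t); rewrite !lsubD {1}Hf {1}Hg mulrDr addrACA.
exists (lsub B (pi f) * t + s * lsub B (pi g) + L * s * t).
by rewrite !lsubM {1}Hf {1}Hg; ring.
Qed.

Hypotheses (homI : homog_ideal I) (satI : saturated I).
Hypotheses (n_gt0 : (0 < n)%N) (regL : nonzerodivisor I L).

Let hI : is_ideal (fun=> True) I. Proof. by case: homI. Qed.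

(** The ideal of the section before saturation. *)
Definition bar (g : R) := exists f, I f /\ g = pi f.
Local Notation IX := (hyperplane_section A I).

Lemma bar_ideal : is_ideal (fun=> True) bar.
Proof.
have [B [_ [BA _]]] := splitting.
apply: is_idealP => [|_ _ [f [If ->]] [g [Ig ->]]|b _ [f [If ->]]].
- by exists 0; rewrite lsub0; split=> //; apply: ideal0.
- by exists (f + g); rewrite lsubD; split=> //; apply: idealD.
- by exists (lsub B b * f); rewrite lsubM pi_lift //; split=> //; apply: ideal_mull.
Qed.

Lemma IX_ideal : is_ideal (fun=> True) IX.
Proof. exact: saturation_ideal bar_ideal. Qed.

Lemma IX_saturated : saturated IX.
Proof. exact: saturation_saturated bar_ideal. Qed.

Lemma bar_IX g : bar g -> IX g.
Proof. exact: (saturation_sub bar_ideal). Qed.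

Lemma bar_pz b g : bar g -> bar (pz b g).
Proof. by move=> [f [If ->]]; exists (pz b f); rewrite pz_lsub; split=> //; apply: pz_ideal. Qed.

Lemma IX_homog : homog_ideal IX.
Proof.
split; first exact: IX_ideal.
move=> f d [e he]; exists e => j; rewrite -[pihomog mdeg d f]/(pz d f).
by rewrite -(pzM _ _ (hzVn e j)); apply/bar_pz/he.
Qed.

Lemma pi_I f : bar (pi f) -> exists s, I (f + L * s).
Proof.
move=> [g [Ig eq_fg]]; have [|s def_s] := @pi_ker (g - f).
  by rewrite lsubB eq_fg subrr.
by exists s; rewrite -def_s addrC subrK.
Qed.

(** Restricted ambient variables are combinations of the variables of the hyperplane, and conversely
    in [power_IX]; hence saturation can be tested on the ambient charts. *)
Lemma IX_power h : IX (pi h) -> exists E, forall l, bar (pi (X l) ^+ E * pi h).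
Proof.
move=> [e he]; suff /fin_all_exists[E hE] : forall l : 'I_N, exists e, bar (pi (X l) ^+ e * pi h).
  exists (\max_l E l)%N => l; rewrite -(subnK (leq_bigmax l)) exprD -mulrA.
  exact: (ideal_mull _ bar_ideal).
move=> l; rewrite lsubX; apply: (kills_power_lin_form _ bar_ideal) => j.
by exists e.
Qed.

Lemma power_IX h : (forall l, exists E, bar (pi (X l) ^+ E * pi h)) -> IX (pi h).
Proof.
have [B [_ [BA _]]] := splitting.
move=> hE; apply/(saturationP _ bar_ideal) => j.
have -> : Y j = \sum_l (B j l)%:MP * pi (X l).
  rewrite -(pi_lift (Y j) BA) lsubX /lin_form lsub_sum; apply: eq_bigr => l _.
  by rewrite lsubZ mul_mpolyC mxE.
exact: (kills_power_sum bar_ideal).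
Qed.

Definition delta (t : 'I_N -> K) : 'M[K]_N := \matrix_(i, j) (t j - t i).

(** Some x_l^E h + L s lies in [I], so s / x_l^E is the quotient of -h by [L] on the chart of C.
    Replacing [s] by one component makes it homogeneous. *)
Lemma sec_of_IX h d : IX (pi h) -> hz d h -> exists t : 'I_N -> K, forall l,
  [/\ sec (@whole k _) (X l) (t l), hdeg (d - 1) (t l) & sec I (X l) (L%:F * t l + h%:F)].
Proof.
move=> /IX_power[E hE] hh; suff ex l : exists z, [/\ sec (@whole k _) (X l) z,
    hdeg (d - 1) z & sec I (X l) (L%:F * z + h%:F)] by have [t ht] := fin_all_exists ex; exists t.
have [s Is] : exists s, I (X l ^+ E * h + L * s) by apply: pi_I; rewrite lsubM lsubXn.
pose s' := pz (d - 1 + E%:Z) s.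
have Is' : I (X l ^+ E * h + L * s').
  have := pz_ideal (E%:Z + d) homI Is; rewrite linearD /= pzM; last exact: hzVn.
  by rewrite pz_id // (_ : E%:Z + d = 1 + (d - 1 + E%:Z)) ?pzM //; [exact: hz_lin_form|ring].
have XE : (X l)%:F ^+ E != 0 :> K by rewrite expf_neq0 // varF_neq0.
exists (s'%:F / (X l)%:F ^+ E); split; first by exists s', E.
  exact/hdeg_divX/hz_pz.
exists (X l ^+ E * h + L * s'), E; split=> //.
by rewrite tofracD !tofracM tofracXn mulrDl addrC mulrA (mulrC (_ ^+ E)) mulfK.
Qed.

(** Converse of [sec_of_IX]: clear the denominators and restrict, which kills the multiple of
    [L]. *)
Lemma IX_of_sec h (t : 'I_N -> K) : (forall l, sec (@whole k _) (X l) (t l)) ->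
  (forall l, sec I (X l) (L%:F * t l + h%:F)) -> IX (pi h).
Proof.
move=> tX tI; apply: power_IX => l; have [s [e1 [_ ts]]] := tX l.
have [f [e2 [If tf]]] := tI l; exists (e1 + e2)%N; exists (X l ^+ e1 * f).
split; first exact: ideal_mull.
have XE e : (X l)%:F ^+ e != 0 :> K by rewrite expf_neq0 // varF_neq0.
have {}ts : s%:F = (X l)%:F ^+ e1 * t l by rewrite ts mulrC divfK.
have {}tf : f%:F = (X l)%:F ^+ e2 * (L%:F * t l + h%:F) by rewrite tf mulrC divfK.
have -> : X l ^+ e1 * f = X l ^+ (e1 + e2) * h + L * (X l ^+ e2 * s).
  apply: tofrac_inj; rewrite tofracD !tofracM !tofracXn tf ts exprD.
  have eq_ring (T : comNzRingType) (x1 x2 y z w : T) :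
    x1 * (x2 * (y * z + w)) = x1 * x2 * w + y * (x2 * (x1 * z)) by ring.
  exact: eq_ring.
by rewrite lsubD !lsubM pi_L mul0r addr0 lsubXn.
Qed.

Lemma delta_Z1 m (t : 'I_N -> K) :
  (forall l, sec (@whole k _) (X l) (t l)) -> (forall l, hdeg m (t l)) ->
  (forall i j, sec I (X i * X j) (L%:F * (t j - t i))) -> Z1 I (hdeg m) (delta t).
Proof.
move=> tX tm tI; split=> [i j|i j l]; last by rewrite !mxE [RHS]addrC subrKA.
rewrite mxE; split; last exact: hdegB.
have XX : X i * X j != 0 by rewrite mulf_neq0 // varX_neq0.
apply: (sec_nonzerodivisor hI XX regL) => //; apply: secB => //.
  by apply: sec_mull => //; rewrite varX_neq0.
by apply: sec_mulr => //; rewrite varX_neq0.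
Qed.

Hypothesis buchsbaum : arith_Buchsbaum I.

(* On C the restriction of h to the hyperplane is - L t for a cochain t, so delta t is a
   cocycle to which the Buchsbaum property applies. *)
Lemma irrelevant_IX h d p : IX (pi h) -> hz d h -> bar (pi (X p) * pi h).
Proof.
move=> Ih hh; have [t ht] := sec_of_IX Ih hh.
have Xi0 l := varX_neq0 k l.
have /buchsbaum/(_ p)[u [hu ut]] : Z1 I (hdeg (d - 1)) (delta t).
  apply: delta_Z1 => [l|l|i j]; try by case: (ht l).
  have -> : L%:F * (t j - t i) = (L%:F * t j + h%:F) - (L%:F * t i + h%:F) :> K.
    by rewrite mulrBr opprD addrACA subrr addr0.
  apply: secB => //; first by rewrite mulf_neq0 ?varX_neq0.
    by apply: sec_mull => //; case: (ht j).
  by apply: sec_mulr => //; case: (ht i).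
(* As [u] is a primitive of x_p times [delta t], the differences x_p t_i - u_i agree on all charts
   and glue to a polynomial [T]. Then x_p h + L T lies in [I] and restricts to the required
   product. *)
have eq_u i : (X p)%:F * t ord0 - u ord0 = (X p)%:F * t i - u i.
  by apply: mulrB_swap; have := ut ord0 i; rewrite !mxE.
have [||T defT] := @glue_whole k n.+1 ((X p)%:F * t ord0 - u ord0); first by [].
  move=> i; rewrite (eq_u i); apply: secB => //; first by apply: secMp => //; case: (ht i).
  by have [/sec_whole] := hu i.
have gluei i : (X p)%:F * t i - u i = T%:F by rewrite -eq_u.
exists (X p * h + L * T); split; last by rewrite lsubD !lsubM pi_L mul0r addr0.
apply: (glue_ideal hI satI) => i.
have -> : (X p * h + L * T)%:F = (X p)%:F * (L%:F * t i + h%:F) - L%:F * u i :> K.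
  rewrite tofracD !tofracM -(gluei i).
  have eq_ring (T' : comNzRingType) (x y z w v : T') :
    x * y + z * (x * w - v) = x * (z * w + y) - z * v by ring.
  exact: eq_ring.
apply: secB => //; first by apply: secMp => //; case: (ht i).
by apply: secMp => //; case: (hu i).
Qed.

(* t is a section of O_C(m) with coboundary c, and x_p t = - G p on C. *)
Definition presents m (c : 'M[K]_N) (G : 'I_N -> S) (t : 'I_N -> K) :=
  [/\ forall p, hz (m + 1) (G p), forall i j, c i j = t j - t i
    & forall p i, sec I (X i) ((X p)%:F * t i + (G p)%:F)].

Lemma pres_whole m c G t i : presents m c G t -> sec (@whole k _) (X i) (t i).
Proof.
move=> [_ _ tI]; have -> : t i = ((X i)%:F * t i + (G i)%:F - (G i)%:F) / (X i)%:F.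
  by rewrite addrK mulrC mulKf // varF_neq0.
apply: sec_div; apply: secB; rewrite ?varX_neq0 //; last exact: sec_poly.
exact: sec_whole (tI i i).
Qed.

Lemma presents_lc m x c c' G G' t t' : presents m c G t -> presents m c' G' t' ->
  presents m (lc x c c') (fun p => x%:MP * G p + G' p) (fun i => (x%:MP : S)%:F * t i + t' i).
Proof.
move=> [hG ct tI] [hG' ct' tI']; split=> [p|i j|p i].
- by apply: hzD => //; rewrite -[m + 1]add0r; apply: hzM => //; apply: hzC.
- by rewrite !mxE ct ct' mulrBr opprD addrACA.
have -> : (X p)%:F * ((x%:MP : S)%:F * t i + t' i) + (x%:MP * G p + G' p)%:F =
    (x%:MP : S)%:F * ((X p)%:F * t i + (G p)%:F) + ((X p)%:F * t' i + (G' p)%:F) :> K.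
  rewrite tofracD tofracM.
  have eq_ring (T' : comNzRingType) (y z w v g g' : T') :
    y * (z * w + v) + (z * g + g') = z * (y * w + g) + (y * v + g') by ring.
  exact: eq_ring.
by apply: secD; rewrite ?varX_neq0 //; apply: secMp.
Qed.

(** The Koszul 2-cocycle of [c] need not bound in [I], but it bounds in [S] since 2 < N; [G p] is
    the degree m + 1 part of the primitive at e_p. *)
Lemma pres_exists m c : Z1 I (hdeg m) c -> exists G t, presents m c G t.
Proof.
move=> Zc; have socc : soc_cocycle I m c by split=> // l; apply: buchsbaum.
have szx : size (vars k (enum 'I_N)) = N by rewrite size_map size_enum_ord.
have [//|W [cW [IW hW W0 kW]]] := socle_koszul hI satI _ socc.
have kd_const (y : seq bool -> S) b :
    const_mx (kd (vars k (enum 'I_N)) (y : seq bool -> S^o) b) =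
    kd (vars k (enum 'I_N)) (fun d => const_mx (y d) : 'rV[S]_1) b.
  rewrite -[vars k (enum 'I_N) in RHS]map_id.
  apply: (kd_morph (M := S^o) (f := const_mx : {additive S^o -> 'rV[S]_1}) (g := id)).
  by move=> x y' _; apply/rowP => j; rewrite !mxE.
have [|||z [_ Wz]] := @kd_exact k N 1 1 (fun b => const_mx (W b)).
- by [].
- by move=> b /W0 ->; apply/rowP => j; rewrite !mxE.
- by move=> b szb; rewrite -kd_const kW //; apply/rowP => j; rewrite !mxE.
pose y b := pz (m + 1) (z b 0 0).
have yW b : size b = N -> W b = kd (vars k (enum 'I_N)) (y : seq bool -> S^o) b.
  move=> szb; have : const_mx (W b) = const_mx (kd (vars k (enum 'I_N)) (y : seq bool -> S^o) b) :> 'rV_1.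
    rewrite kd_const -[LHS](@pzv_id _ _ _ (fun=> 0) (1 + (m + 1))); last first.
      by move=> j; rewrite mxE subr0 (_ : 1 + (m + 1) = m + 2) //; ring.
    rewrite Wz // kd_pzv; apply: kd_eq; rewrite ?szx // => d _.
    by apply/rowP => j; rewrite !mxE subr0 ord1.
  by move=> /rowP/(_ 0); rewrite !mxE.
have [u [t [hu ut ct]]] := koszul_of_lift cW yW.
exists (fun p => y (bit (enum 'I_N) p)), t; split=> // [p|p i]; first exact: hz_pz.
rewrite addrC -ut; by have [] := hu p i.
Qed.

(** Extends [irrelevant_IX] from the restricted variables to every variable of [R], by linear
    combination, and then to the monomials of [q], each of which contains a variable. *)
Lemma irrelevant_bar g d q : IX g -> hz d g -> q@_0%MM = 0 -> bar (q * g).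
Proof.
move=> Ig hg q0; have [B [_ [BA _]]] := splitting.
have Yg j : bar (Y j * g).
  have -> : Y j = \sum_l (B j l)%:MP * pi (X l).
    rewrite -(pi_lift (Y j) BA) lsubX /lin_form lsub_sum; apply: eq_bigr => l _.
    by rewrite lsubZ mul_mpolyC mxE.
  rewrite mulr_suml; apply: (ideal_sum bar_ideal) => l _.
  rewrite -mulrA; apply: (ideal_mull _ bar_ideal).
  have [h [hh def_g]] := pi_surj hg; rewrite def_g.
  by apply: (@irrelevant_IX h d); rewrite -?def_g.
rewrite [q]mpolyE big_seq mulr_suml; apply: (big_ind bar) => [|x y|m].
- exact: (ideal0 bar_ideal).
- exact: (idealD bar_ideal).
rewrite mcoeff_msupp => qm; have m0 : m != 0%MM by apply: contraNneq qm => ->; rewrite q0.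
have [j mj] : exists j, m j != 0%N.
  apply/existsP; apply: contraR m0; rewrite negb_exists => /forallP m0.
  by apply/eqP/mnmP => j; rewrite mnm0E; apply/eqP; have := m0 j; rewrite negbK.
rewrite -(@submK _ U_(j) m) ?lep1mP // mpolyXD -mul_mpolyC mulrA -mulrA.
exact: (ideal_mull _ bar_ideal).
Qed.

(** The form that represents - L t on C when [G p] represents - x_p t. *)
Definition along_L (G : 'I_N -> S) := \sum_p (a 0 p)%:MP * G p.

Lemma L_sum : L%:F = \sum_p ((a 0 p)%:MP : S)%:F * (X p)%:F :> K.
Proof. by rewrite rmorph_sum; apply: eq_bigr => p _ /=; rewrite -mul_mpolyC tofracM. Qed.

Lemma pres_L m c G t l : presents m c G t -> sec I (X l) (L%:F * t l + (along_L G)%:F).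
Proof.
move=> [_ _ tI]; rewrite L_sum /along_L rmorph_sum mulr_suml -big_split.
apply: sec_sum; rewrite ?varX_neq0 // => p _ /=.
by rewrite tofracM -mulrA -mulrDr; apply: secMp.
Qed.

Lemma pres_L_IX m c G t : presents m c G t -> IX (pi (along_L G)).
Proof.
move=> ct; apply: (@IX_of_sec _ t) => l; first exact: pres_whole ct.
exact: pres_L ct.
Qed.

Section Resolved.
Variable F : free_complex k n.+1.
Hypothesis resF : minimal_resolution n IX F.
Variable m : int.

Definition gens := [set j : 'I_(rk F 1) | shift F 1 j == m + 1].

(** By [irrelevant_bar], the coefficients of a combination of generators of I_X may be replaced
    modulo [bar] by their constant terms; in degree m + 1 only the generators of that degree keep
    one. *)
Lemma IX_bar_le_dim :
  le_dim (fun (x : k) (g g' : R) => x%:MP * g + g') (fun g => IX g /\ hz (m + 1) g) bar #|gens|.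
Proof.
have [[rk0 shift0] _ _ _ [genF _]] := resF.
have lt0 : (0 < rk F 0)%N by rewrite rk0.
pose j0 := Ordinal lt0; pose f j := diff F 0 j j0.
have j0P j : j = j0 by apply: val_inj => /=; have := ltn_ord j; lia.
have fI j : IX (f j).
  apply/genF; exists (delta_mx 0 j); rewrite -rowE.
  by apply/rowP => i; rewrite !mxE (j0P i).
have fhz j : hz (shift F 1 j) (f j).
  by have := @diff_hz _ _ _ _ resF 0 j j0; rewrite shift0 subr0.
exists (fun g t => bar (g - \sum_(j < #|gens|) (t 0 j)%:MP * f (enum_val j))); split.
- move=> g [Ig hg]; have /genF[v0 v0g] := Ig.
  pose v j := pz (m + 1 - shift F 1 j) (v0 0 j).
  have def_g : g = \sum_j v j * f j.
    rewrite -[LHS](pz_id hg).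
    have -> : g = \sum_j f j * v0 0 j.
      have := congr1 (fun M : 'rV_(rk F 0) => M 0 j0) v0g; rewrite !mxE => <-.
      by apply: eq_bigr => j _; rewrite mulrC.
    rewrite linear_sum; apply: eq_bigr => j _ /=.
    by rewrite [RHS]mulrC /v -(pzM _ _ (fhz j)) [_ + (m + 1 - _)]addrC subrK.
  exists (\row_j (v (enum_val j))@_0%MM).
  have -> : \sum_(j < #|gens|) ((\row_j (v (enum_val j))@_0%MM) 0 j)%:MP * f (enum_val j) =
      \sum_j ((v j)@_0%MM)%:MP * f j.
    under eq_bigr => j _ do rewrite mxE.
    rewrite -(big_enum_val (fun j => ((v j)@_0%MM)%:MP * f j)) big_mkcond.
    apply: eq_bigr => j _; case: ifPn => //; rewrite inE => ne.
    rewrite [(v j)@_0%MM](_ : _ = 0) ?mpolyC0 ?mul0r //; apply/eqP; apply: contraNT ne.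
    by move/(hz_pz _ _); rewrite mdeg0 => /esym/eqP; rewrite subr_eq0 eq_sym.
  rewrite def_g -sumrB; apply: (ideal_sum bar_ideal) => j _; rewrite -mulrBl.
  apply: (irrelevant_bar (fI j) (fhz j)).
  by rewrite mcoeffB mcoeffC eqxx mulr1 subrr.
- move=> x g g' t t' Bg Bg'; rewrite (_ : _ - _ =
    x%:MP * (g - \sum_(j < #|gens|) (t 0 j)%:MP * f (enum_val j)) +
    (g' - \sum_(j < #|gens|) (t' 0 j)%:MP * f (enum_val j))).
    by apply: (idealD bar_ideal) => //; apply: (ideal_mull _ bar_ideal).
  rewrite mulrBr addrACA -opprD mulr_sumr -big_split; congr (_ - _).
  by apply: eq_bigr => j _ /=; rewrite !mxE mpolyCD mpolyCM mulrDl mulrA.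
move=> g _; rewrite big1 ?subr0 // => j _.
by rewrite mxE mpolyC0 mul0r.
Qed.

Theorem generators_le_dim :
  le_dim (@lc k n.+1) (Z1 I (hdeg m)) (B1 I (hdeg m)) #|gens|.
Proof.
pose psi c g := exists G t, presents m c G t /\ g = pi (along_L G).
apply: (le_dim_pull (psi := psi) IX_bar_le_dim).
- by move=> c /pres_exists[G [t ct]]; exists (pi (along_L G)), G, t.
- move=> c _ [G [t [ct ->]]]; have [hG _ _] := ct; split.
    exact: pres_L_IX ct.
  apply: hz_lsub; apply: hz_sum => p _; rewrite -[m + 1]add0r.
  by apply: hzM; [exact: hzC|exact: hG].
- move=> x c1 c2 _ _ [G1 [t1 [p1 ->]]] [G2 [t2 [p2 ->]]].
  exists (fun p => x%:MP * G1 p + G2 p), (fun i => (x%:MP : S)%:F * t1 i + t2 i).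
  split; first exact: presents_lc.
  rewrite -(lsubC A) -lsubM -lsubD /along_L mulr_sumr -big_split; congr (pi _).
  by apply: eq_bigr => p _ /=; rewrite mulrDr mulrCA.
(* With G_L + L s in [I], also L (t - s) lies in [I] on every chart. Since [L] is regular, t - s is
   a primitive of [c] with values in [I]. *)
move=> c _ [Zc _] [G [t [ct ->]]] /pi_I[s Is]; have [_ c_t _] := ct.
apply: (B1_homog homI) => [i j|]; first by case: (Zc i j).
exists (fun l => t l - s%:F); split=> [l|i j]; last first.
  by rewrite c_t opprB addrA subrK.
split=> //; have Xl := varX_neq0 k l.
apply: (sec_nonzerodivisor hI Xl regL).
  by apply: secB => //; [exact: pres_whole ct|exact: sec_poly].
have -> : L%:F * (t l - s%:F) = (L%:F * t l + (along_L G)%:F) - (along_L G + L * s)%:F :> K.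
  by rewrite mulrBr tofracD tofracM opprD addrA addrK.
by apply: secB => //; [exact: pres_L ct|exact: sec_poly].
Qed.

End Resolved.

(** * Restriction of cohomology classes to the socle of the section *)

Local Notation KR := {fraction R}.

(** Both products represent - x_p x_q t on C. *)
Lemma pres_cross m c G t p q : presents m c G t -> I (X p * G q - X q * G p).
Proof.
move=> [_ _ tI]; apply: (glue_ideal hI satI) => i.
have -> : (X p * G q - X q * G p)%:F =
    (X p)%:F * ((X q)%:F * t i + (G q)%:F) - (X q)%:F * ((X p)%:F * t i + (G p)%:F) :> K.
  rewrite tofracB !tofracM.
  have eq_ring (T : comNzRingType) (x y z w v : T) :
    x * w - y * z = x * (y * v + w) - y * (x * v + z) by ring.
  exact: eq_ring.
by apply: secB; rewrite ?varX_neq0 //; apply: secMp.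
Qed.

(** For [B] a left inverse of [A], the variable y_j is the same combination of the restricted x_l,
    so this form represents - y_j t on X. *)
Definition restr (B : 'M[k]_(n.+1, N)) (G : 'I_N -> S) (j : 'I_n.+1) : R :=
  \sum_l (B j l)%:MP * pi (G l).

Lemma restr_var B j : B *m A = 1%:M -> Y j = \sum_l (B j l)%:MP * pi (X l).
Proof.
move=> BA; rewrite -(pi_lift (Y j) BA) lsubX /lin_form lsub_sum; apply: eq_bigr => l _.
by rewrite lsubZ mul_mpolyC mxE.
Qed.

Lemma restr_cross m c G t B i j : B *m A = 1%:M -> presents m c G t ->
  IX (Y i * restr B G j - Y j * restr B G i).
Proof.
move=> BA ct; rewrite (restr_var i BA) (restr_var j BA) /restr.
rewrite !mulr_suml [Z in _ - Z](eq_bigr (fun l => \sum_l'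
    (B j l)%:MP * pi (X l) * ((B i l')%:MP * pi (G l')))); last by move=> l _; rewrite mulr_sumr.
rewrite exchange_big -sumrB; apply: (ideal_sum IX_ideal) => l _.
rewrite mulr_sumr -sumrB; apply: (ideal_sum IX_ideal) => l' _.
have -> : (B i l)%:MP * pi (X l) * ((B j l')%:MP * pi (G l')) -
    (B j l')%:MP * pi (X l') * ((B i l)%:MP * pi (G l)) =
    (B i l)%:MP * (B j l')%:MP * pi (X l * G l' - X l' * G l).
  by rewrite lsubB !lsubM; ring.
apply: (ideal_mull _ IX_ideal); apply: bar_IX; exists (X l * G l' - X l' * G l).
by split=> //; apply: pres_cross ct.
Qed.

(** With g = [restr B G], the quotient g_j / y_j stands for - t on X, so up to sign this restricts
    the coboundary of t. *)
Definition restr_cocycle (g : 'I_n.+1 -> R) : 'M[KR]_n.+1 :=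
  \matrix_(i, j) ((g j)%:F / (Y j)%:F - (g i)%:F / (Y i)%:F).

Lemma restr_cocycle_soc m g : (forall j, hz (m + 1) (g j)) ->
  (forall i j, IX (Y i * g j - Y j * g i)) -> soc_cocycle IX m (restr_cocycle g).
Proof.
move=> hg cross; have Y0 (j : 'I_n.+1) : (Y j)%:F != 0 :> KR by exact: varF_neq0.
have gdeg j : hdeg m ((g j)%:F / (Y j)%:F : KR).
  by rewrite -[(Y j)%:F]expr1; apply: hdeg_divX.
split; first split=> [i j|i j l]; rewrite ?mxE.
- split; last exact: hdegB.
  exists (Y i * g j - Y j * g i), 1%N; split=> //.
  by rewrite (sub_frac _ _ (Y0 i) (Y0 j)) expr1 tofracB !tofracM.
- by rewrite [RHS]addrC subrKA.
(* Subtracting g_l on all charts leaves the coboundary unchanged and turns the numerator into y_l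
   g_i - y_i g_l, which is in I_X. *)
move=> l; exists (fun i => (Y l)%:F * ((g i)%:F / (Y i)%:F) - (g l)%:F); split=> [i|i j].
  split; last first.
    apply: hdegB; last by apply/hdeg_poly.
    by rewrite addrC; apply: hdegM => //; apply: hdegX.
  exists (Y l * g i - Y i * g l), 1%N; split=> //.
  rewrite expr1 tofracB !tofracM mulrBl mulrA; congr (_ - _).
  by rewrite mulrAC mulfV // mul1r.
by rewrite !mxE mulrBr opprB addrA subrK.
Qed.

Theorem socle_le_dim m s : soc_H1_dim IX m s ->
  le_dim (@lc k n.+1) (Z1 I (hdeg m)) (B1 I (hdeg m)) s.
Proof.
move=> dim_s; have [B [e [BA ABe]]] := splitting.
have Bclosed x (c c' : 'M[KR]_n.+1) :
    B1 IX (hdeg m) c -> B1 IX (hdeg m) c' -> B1 IX (hdeg m) (lc x c c').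
  by apply: B1_lc; [exact: IX_ideal|exact: lclosed_hdeg].
have le_s := qdim_le_dim_self Bclosed dim_s.
pose psi c c' := exists G t, presents m c G t /\ c' = restr_cocycle (restr B G).
apply: (le_dim_pull (psi := psi) le_s).
- by move=> c /pres_exists[G [t ct]]; exists (restr_cocycle (restr B G)), G, t.
- move=> c _ [G [t [ct ->]]]; apply: restr_cocycle_soc => [j|i j]; last exact: restr_cross ct.
  have [hG _ _] := ct; apply: hz_sum => l _; rewrite -[m + 1]add0r.
  by apply: hzM; [exact: hzC|apply/hz_lsub/hG].
- move=> x c1 c2 _ _ [G1 [t1 [p1 ->]]] [G2 [t2 [p2 ->]]].
  exists (fun p => x%:MP * G1 p + G2 p), (fun i => (x%:MP : S)%:F * t1 i + t2 i).
  split; first exact: presents_lc.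
  have restrD j : restr B (fun p => x%:MP * G1 p + G2 p) j = x%:MP * restr B G1 j + restr B G2 j.
    rewrite /restr mulr_sumr -big_split; apply: eq_bigr => l _ /=.
    by rewrite lsubD lsubM lsubC mulrDr mulrCA.
  apply/matrixP => i j; rewrite !mxE !restrD !tofracD !tofracM.
  by rewrite !mulrDl mulrBr !mulrA opprD addrACA.
move=> c c' [Zc _] [G [t [ct ->]]] [z [hz' cz]]; have [hG c_t tI] := ct.
have Y0 (j : 'I_n.+1) : (Y j)%:F != 0 :> KR by exact: varF_neq0.
(* The class of c becomes trivial on X only if, up to a form T, every G l restricts into I_X. *)
have [T [hT T_I]] : exists T, hz m T /\ forall l, IX (pi (G l - X l * T)).
  have eqT i j : (restr B G j)%:F / (Y j)%:F - z j = (restr B G i)%:F / (Y i)%:F - z i.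
    by apply: subr_swap; rewrite -cz mxE.
  have [||T0 defT0] := @glue_whole k n ((restr B G ord0)%:F / (Y ord0)%:F - z ord0); first by [].
    move=> i; rewrite (eqT i ord0); apply: secB => //; rewrite ?varX_neq0 //.
      by apply/sec_div/sec_poly.
    by have [/sec_whole] := hz' i.
  have restr_IX j : IX (restr B G j - Y j * T0).
    apply: (glue_ideal IX_ideal IX_saturated) => i.
    have -> : (restr B G j - Y j * T0)%:F =
        (Y i * restr B G j - Y j * restr B G i)%:F / (Y i)%:F + (Y j)%:F * z i :> KR.
      by rewrite !tofracB !tofracM -defT0 (eqT i ord0) (frac_shift _ _ _ _ (Y0 i)).
    apply: (secD IX_ideal (varX_neq0 k i)).
      by apply/sec_div/sec_poly; apply: restr_cross ct.
    by apply: (secMp _ IX_ideal); case: (hz' i).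
  have hT0 : hz m T0.
    apply/hdeg_poly; rewrite -defT0; apply: hdegB; last by case: (hz' ord0).
    rewrite -[(Y ord0)%:F]expr1; apply: hdeg_divX.
    apply: hz_sum => l _; rewrite -[m + 1]add0r.
    by apply: hzM; [exact: hzC|apply/hz_lsub/hG].
  have [T [hT def_T0]] := pi_surj hT0; exists T; split=> // l.
  pose H p := pi (G p - X p * T).
  have B_H j : IX (\sum_p (B j p)%:MP * H p).
    have := restr_IX j; congr IX; rewrite (restr_var j BA) mulr_suml -sumrB.
    by apply: eq_bigr => p _; rewrite /H lsubB lsubM mulrBr mulrA -def_T0.
  have a_H : IX (\sum_p (a 0 p)%:MP * H p).
    have := pres_L_IX ct; congr IX.
    transitivity (pi (along_L G - L * T)); first by rewrite lsubB lsubM pi_L mul0r subr0.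
    rewrite /along_L /lin_form mulr_suml -sumrB lsub_sum.
    by apply: eq_bigr => p _; rewrite -mul_mpolyC -mulrA -mulrBr lsubM lsubC.
  (* By A B + e a = 1, each [H l] is a combination of the sums taken along the rows of [B] and along
     [a], which are in I_X. *)
  have -> : pi (G l - X l * T) =
      \sum_j (A l j)%:MP * (\sum_p (B j p)%:MP * H p) + (e l 0)%:MP * \sum_p (a 0 p)%:MP * H p.
    transitivity (\sum_p ((1%:M : 'M[k]_N) l p)%:MP * H p).
      rewrite (bigD1 l) //= mxE eqxx mpolyC1 mul1r big1 ?addr0 // => p /negPf ne.
      by rewrite mxE eq_sym ne mpolyC0 mul0r.
    rewrite mulr_sumr [Z in _ = Z + _](eq_bigr (fun j => \sum_p (A l j)%:MP * ((B j p)%:MP * H p))).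
      rewrite exchange_big -big_split; apply: eq_bigr => p _ /=.
      rewrite -ABe !mxE big_ord1 mpolyCD mulrDl mpolyCM -mulrA; congr (_ + _).
      by rewrite rmorph_sum mulr_suml; apply: eq_bigr => j _; rewrite rmorphM mulrA.
    by move=> j _; rewrite mulr_sumr.
  apply: (idealD IX_ideal); last exact: (ideal_mull _ IX_ideal).
  by apply: (ideal_sum IX_ideal) => j _; apply: (ideal_mull _ IX_ideal).
have Xinv l : hdeg (-1) ((X l)%:F^-1 : K).
  rewrite -div1r -tofrac1; apply: (hdeg_frac _ (hzX l)); last exact: varX_neq0.
  by rewrite addNr; apply: hzC.
have Xdiv l (w : K) : w = ((X l)%:F * w) / (X l)%:F by rewrite mulrC mulKf // varF_neq0.
(* On the chart of x_l, t_l + T is L w modulo [I]: divide by x_l the section that [sec_of_IX]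
   attaches to G_l - x_l T. *)
have ex_tau l : exists w : K, [/\ sec (@whole k _) (X l) w, hdeg (m - 1) w
    & sec I (X l) (t l + T%:F - L%:F * w)].
  have [|tau htau] := sec_of_IX (T_I l) (d := m + 1).
    by apply: hzB => //; rewrite addrC; apply: hzM => //; apply: hzX.
  have [w_whole w_deg w_sec] := htau l; exists (tau l / (X l)%:F); split.
  - exact: sec_div.
  - by rewrite -[m](addrK 1); apply: hdegM.
  have -> : t l + T%:F - L%:F * (tau l / (X l)%:F) = (((X l)%:F * t l + (G l)%:F) -
      (L%:F * tau l + (G l - X l * T)%:F)) / (X l)%:F.
    rewrite {1}[t l + _](Xdiv l) tofracB tofracM mulrA -mulrBl; congr (_ / _).
    have eq_ring (T' : comNzRingType) (x y b v w : T') :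
      x * (y + b) - v = x * y + w - (v + (w - x * b)) by ring.
    exact: eq_ring.
  by apply/sec_div/secB; rewrite ?varX_neq0.
have [tau htau] := fin_all_exists ex_tau.
have tau_whole l : sec (@whole k _) (X l) (tau l) by case: (htau l).
have tau_deg l : hdeg (m - 1) (tau l) by case: (htau l).
have tau_sec l : sec I (X l) (t l + T%:F - L%:F * tau l) by case: (htau l).
have c_tau i j : c i j = L%:F * (tau j - tau i) +
    ((t j + T%:F - L%:F * tau j) - (t i + T%:F - L%:F * tau i)).
  rewrite c_t.
  have eq_ring (T' : comNzRingType) (x y b v w d : T') :
    x - y = b * (v - w) + ((x + d - b * v) - (y + d - b * w)) by ring.
  exact: eq_ring.
have Ztau : Z1 I (hdeg (m - 1)) (delta tau).
  apply: delta_Z1; [exact: tau_whole|exact: tau_deg|move=> i j].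
  have sij : sec I (X i * X j) (c i j) by case: (Zc i j).
  have XX : X i * X j != 0 by rewrite mulf_neq0 // varX_neq0.
  have -> : L%:F * (tau j - tau i) =
      c i j - ((t j + T%:F - L%:F * tau j) - (t i + T%:F - L%:F * tau i)) by rewrite c_tau addrK.
  apply: secB => //; apply: secB => //.
    by apply: sec_mull => //; rewrite varX_neq0.
  by apply: sec_mulr => //; rewrite varX_neq0.
(* Weighting the primitives of x_p times [delta tau] by [a 0 p] gives one of L times [delta tau],
   from which [c] differs by a coboundary with values in [I]. *)
have [u hu] := fin_all_exists (buchsbaum Ztau).
apply: (B1_homog homI) => [i j|]; first by case: (Zc i j).
exists (fun i => \sum_p ((a 0 p)%:MP : S)%:F * u p i + (t i + T%:F - L%:F * tau i)).
split=> [i|i j].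
  split=> //; apply: secD; rewrite ?varX_neq0 //.
  apply: sec_sum; rewrite ?varX_neq0 // => p _; apply: secMp => //.
  by have [hup _] := hu p; have [] := hup i.
rewrite c_tau [RHS](_ : _ = \sum_p ((a 0 p)%:MP : S)%:F * u p j -
  \sum_p ((a 0 p)%:MP : S)%:F * u p i + ((t j + T%:F - L%:F * tau j) - (t i + T%:F - L%:F * tau i))).
  rewrite L_sum mulr_suml -sumrB; congr (_ + _).
  apply: eq_bigr => p _; rewrite -mulrBr -mulrA; congr (_ * _).
  by have [_ <-] := hu p; rewrite !mxE.
by rewrite [in LHS]opprD addrACA.
Qed.

End Hyperplane.

(** * The graded pieces together *)

Lemma frac_additive (F : fieldType) (x y z p q r : F) : x != 0 -> y != 0 -> z != 0 ->
  p / (x * z) = q / (x * y) + r / (y * z) <-> y * p = z * q + x * r.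
Proof.
move=> x0 y0 z0; have xyz : x * y * z != 0 by rewrite !mulf_neq0.
have -> : p / (x * z) = (y * p) / (x * y * z) by field; rewrite x0 y0 z0.
have -> : q / (x * y) + r / (y * z) = (z * q + x * r) / (x * y * z).
  by field; rewrite x0 y0 z0.
by split=> [|->] //; apply: mulIf; rewrite invr_eq0.
Qed.

Section TotalDegree.
Variables (k : closedFieldType) (n : nat).
Local Notation N := n.+1.
Local Notation S := {mpoly k[N]}.
Local Notation K := {fraction {mpoly k[N]}}.
Local Notation X i := ('X_i : S).
Variable I : S -> Prop.
Hypothesis homI : homog_ideal I.

Let hI : is_ideal (fun=> True) I. Proof. by case: homI. Qed.

Lemma soc_lc m x c c' :
  soc_cocycle I m c -> soc_cocycle I m c' -> soc_cocycle I m (lc x c c').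
Proof.
move=> [Zc sc] [Zc' sc']; split; first exact: (Z1_lc _ hI (lclosed_hdeg k n m)).
move=> l; have -> : (X l)%:F *: lc x c c' = lc x ((X l)%:F *: c) ((X l)%:F *: c') :> 'M[K]_N.
  by rewrite /lc scalerDr !scalerA mulrC.
exact: (B1_lc _ hI (lclosed_hdeg k n (m + 1))).
Qed.

Lemma soc_0 m : soc_cocycle I m 0.
Proof.
split=> [|l]; first exact: (Z1_0 hI (lclosed_hdeg k n m)).
by rewrite scaler0; apply: (B1_0 hI (lclosed_hdeg k n (m + 1))).
Qed.

(** Over a common exponent [E] the cocycle condition is a polynomial identity between numerators, so
    it holds for each homogeneous component of them. *)
Lemma Z1_homog_sum (c : 'M[K]_N) : Z1 I anydeg c -> exists (b : nat) (cs : 'I_b -> 'M[K]_N),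
  (forall d, exists m, Z1 I (hdeg m) (cs d)) /\ c = \sum_d cs d.
Proof.
move=> [hc cc]; have XX i j : X i * X j != 0 by rewrite mulf_neq0 // varX_neq0.
have /fin_all_exists[e0 he] : forall ij : 'I_N * 'I_N, exists e0, forall e, (e0 <= e)%N ->
    exists f, I f /\ c ij.1 ij.2 = f%:F / (X ij.1 * X ij.2)%:F ^+ e.
  by move=> [i j]; apply: sec_ge => //; case: (hc i j).
pose E := (\max_ij e0 ij)%N.
have /fin_all_exists[f0 hf0] : forall ij : 'I_N * 'I_N, exists f,
    I f /\ c ij.1 ij.2 = f%:F / (X ij.1 * X ij.2)%:F ^+ E.
  by move=> ij; apply: he; apply: leq_bigmax.
pose f i j := f0 (i, j).
have If i j : I (f i j) by case: (hf0 (i, j)).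
have cf i j : c i j = (f i j)%:F / ((X i)%:F ^+ E * (X j)%:F ^+ E).
  by have [_ ->] := hf0 (i, j); rewrite tofracM exprMn.
have XE l : (X l)%:F ^+ E != 0 :> K by rewrite expf_neq0 // varF_neq0.
pose b := (\max_ij msize (f0 ij))%N.
pose cs (d : 'I_b) : 'M[K]_N := \matrix_(i, j) ((pz d (f i j))%:F / ((X i)%:F ^+ E * (X j)%:F ^+ E)).
exists b, cs; split=> [d|]; last first.
  apply/matrixP => i j; rewrite cf summxE.
  under eq_bigr => d _ do rewrite mxE.
  rewrite -mulr_suml -rmorph_sum; congr (_%:F / _).
  exact/pihomog_partitionE/(@leq_bigmax _ (fun ij => msize (f0 ij)) (i, j)).
exists (d%:Z - (E + E)%N%:Z); split=> [i j|i j l].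
  rewrite mxE; split.
    by exists (pz d (f i j)), E; rewrite tofracM exprMn; split=> //; apply: pz_ideal.
  rewrite -!tofracXn -tofracM; apply: (@hdeg_frac _ _ _ (E + E)%N).
  - by rewrite subrK; apply: hz_pz.
  - by rewrite PoszD; apply: hzM; apply: hzVn.
  - by rewrite mulf_neq0 // expf_neq0 // varX_neq0.
rewrite !mxE; apply/(frac_additive _ _ _ (XE i) (XE j) (XE l)).
have := cc i j l; rewrite !cf => /(frac_additive _ _ _ (XE i) (XE j) (XE l)).
rewrite -!tofracXn -!tofracM -tofracD => /tofrac_inj/(congr1 (pz (E%:Z + d%:Z))).
have pzD u v : pz (E%:Z + d%:Z) (u + v) = pz (E%:Z + d%:Z) u + pz (E%:Z + d%:Z) v :> S.
  exact: linearD.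
rewrite pzD !pzM; try exact: hzVn.
by move=> ->; rewrite tofracD.
Qed.

(* Repetitions among the degrees e x are allowed: a spanning family is enough. *)
Lemma total_le_dim (h : int -> nat) (T : finType) (e : T -> int) :
  (forall m, H1_dim I (hdeg m) (h m)) ->
  (forall m, (forall x, m != e x) -> h m = 0%N) ->
  le_dim (@lc k n) (Z1 I anydeg) (B1 I anydeg) (\sum_x h (e x)).
Proof.
move=> dim_h h0.
pose bas m := proj1_sig (constructive_indefinite_description _ (dim_h m)).
have basP m : (forall i, Z1 I (hdeg m) (bas m i)) /\
    forall c, Z1 I (hdeg m) c -> exists a, B1 I (hdeg m) (c - comb (bas m) a).
  by rewrite /bas; case: constructive_indefinite_description => b [].
pose U : finType := {x : T & 'I_(h (e x))}.
pose bU (u : U) := bas (e (tag u)) (tagged u).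
have -> : (\sum_x h (e x) = #|U|)%N.
  rewrite card_tagged sumnE big_map big_enum; apply: eq_bigr => x _.
  by rewrite card_ord.
have B0 := B1_0 hI (@lclosed_any k n).
have Blc x c c' : B1 I anydeg c -> B1 I anydeg c' -> B1 I anydeg (lc x c c').
  exact: (B1_lc x hI (@lclosed_any k n)).
pose sp c := exists a, B1 I anydeg (c - comb bU a).
have sp0 : sp 0.
  exists (fun=> 0); rewrite /comb big1 ?subr0 // => u _.
  by rewrite mpolyC0 tofrac0 scale0r.
have sp_lc x c c' : sp c -> sp c' -> sp (lc x c c').
  move=> [a Ba] [a' Ba']; exists (fun u => x * a u + a' u).
  have := Blc x _ _ Ba Ba'; congr (B1 _ _ _).
  rewrite /lc /comb scalerBr addrACA -opprD scaler_sumr -big_split /=; congr (_ - _).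
  by apply: eq_bigr => u _; rewrite scalerA -scalerDl -tofracM -tofracD mpolyCD mpolyCM.
have sp_B c : B1 I anydeg c -> sp c.
  move=> Bc; exists (fun=> 0); rewrite /comb big1 ?subr0 // => u _.
  by rewrite mpolyC0 tofrac0 scale0r.
have spD c c' : sp c -> sp c' -> sp (c + c').
  move=> sc sc'; have := sp_lc 1 _ _ sc sc'.
  by rewrite /lc mpolyC1 tofrac1 scale1r.
have sp_bU u : sp (bU u).
  exists (fun v => (v == u)%:R); rewrite /comb (bigD1 u) //= eqxx mpolyC1 tofrac1 scale1r.
  rewrite big1 ?addr0 ?subrr // => v /negPf->.
  by rewrite mpolyC0 tofrac0 scale0r.
apply: (spanned_le_dim Blc (b := bU)) => c /Z1_homog_sum[b [cs [hcs ->]]].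
apply: (big_ind sp) => // d _; have [m Zm] := hcs d.
have [_ /(_ _ Zm)[a Ba]] := basP m; rewrite -[cs d](subrK (comb (bas m) a)).
apply: spD; first exact/sp_B/B1_any/Ba.
apply: comb_ind => // i.
have [[x def_m]|nx] := classic (exists x, m = e x).
  by move: i; rewrite def_m => i; apply: (sp_bU (Tagged (fun x => 'I_(h (e x))) i)).
have hm : h m = 0%N by apply: h0 => x; apply/eqP => def_m; apply: nx; exists x.
by have := ltn_ord i; rewrite [Z in (_ < Z)%N]hm.
Qed.

End TotalDegree.

Theorem proposition4p20 (k : closedFieldType) (n : nat) (hn : (0 < n)%N)
  (IC : {mpoly k[n.+2]} -> Prop)
  (hC : curve IC) (hB : arith_Buchsbaum IC) (hCM : ~ arith_CM IC) :
  general_hyperplane (fun a : 'rV[k]_(n.+2) =>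
    forall (A : 'M[k]_(n.+2, n.+1)), \rank A = n.+1 -> a *m A = 0 ->
    let IX := hyperplane_section A IC in
    forall F : free_complex k n.+1, minimal_resolution n IX F ->
    let d := shift F 1 in
    let m := shift F n in
    (forall i j : 'I_(rk F 1), (i <= j)%N -> d j <= d i) ->
    (forall i j : 'I_(rk F n), (i <= j)%N -> m j <= m i) ->
    let J := [set j : 'I_(rk F 1) | [exists l, d j == m l - n%:Z]] in
    let mu := fun j : 'I_(rk F 1) => #|[set j' | d j' == d j]| in
    exists (h s : int -> nat) (D : nat),
      [/\ forall i, H1_dim IC (hdeg i) (h i),
          forall i, soc_H1_dim IX i (s i) &
          H1_dim IC anydeg D]
      /\
      [/\ forall i : int, (forall j, j \in J -> i != d j - 1) -> h i = 0%N,
          forall j, j \in J -> (h (d j - 1)%R <= minn (s (d j - 1)%R) (mu j))%N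
        & (D <= \sum_(j in J) minn (s (d j - 1)%R) (mu j))%N]).
Proof.
have [[homI satI] _ _ _] := hC; have hI : is_ideal (fun=> True) IC by case: homI.
have [e [G [hG G0 regG]]] := generic_linear_nonzerodivisor hI satI.
exists e, G; split=> // a a0 /regG regL A rankA aA IX F resF d m _ _ J mu.
have homIX : homog_ideal IX := IX_homog rankA aA a0 homI.
have satIX : saturated IX := IX_saturated rankA aA a0 homI.
have hIX : is_ideal (fun=> True) IX by case: homIX.
have ZC0 i := Z1_0 hI (lclosed_hdeg k n.+1 i).
have ZClc i x c c' := @Z1_lc _ _ _ _ x c c' hI (lclosed_hdeg k n.+1 i).
have BC0 i := B1_0 hI (lclosed_hdeg k n.+1 i).
have BClc i x c c' := @B1_lc _ _ _ _ x c c' hI (lclosed_hdeg k n.+1 i).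
have le_gens i := generators_le_dim rankA aA a0 homI satI hn regL hB resF i.
have le_tops i := soc_le_dim i hn homIX satIX resF.
have ex_h i : exists hi, H1_dim IC (hdeg i) hi.
  have [hi [_ dim_hi]] := le_dim_qdim (ZC0 i) (ZClc i) (BC0 i) (BClc i) (le_gens i).
  by exists hi.
have ex_s i : exists si, (si <= tops F i n)%N /\ soc_H1_dim IX i si.
  exact: (le_dim_qdim (soc_0 homIX i) (@soc_lc _ _ _ homIX i)
    (B1_0 hIX (lclosed_hdeg k n i)) (fun x c c' => B1_lc x hIX (lclosed_hdeg k n i)) (le_tops i)).
pose h i := proj1_sig (constructive_indefinite_description _ (ex_h i)).
have dim_h i : H1_dim IC (hdeg i) (h i).
  exact: (proj2_sig (constructive_indefinite_description _ (ex_h i))).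
pose s i := proj1_sig (constructive_indefinite_description _ (ex_s i)).
have [s_tops dim_s] : (forall i, s i <= tops F i n)%N /\ forall i, soc_H1_dim IX i (s i).
  by split=> i; case: (proj2_sig (constructive_indefinite_description _ (ex_s i))).
have h_gens i : (h i <= #|gens F i|)%N := qdim_le_dim (ZC0 i) (ZClc i) (dim_h i) (le_gens i).
have h_s i : (h i <= s i)%N.
  apply: (qdim_le_dim (ZC0 i) (ZClc i) (dim_h i)).
  exact: (socle_le_dim rankA aA a0 homI satI hn regL hB (dim_s i)).
(* A nonzero [h i] forces a generator with d_j = i + 1 and, through the socle bound, a last shift
   m_l = i + n + 1. Then d_j = m_l - n, so j is in [J] although i = d_j - 1. *)
have h0 i : (forall j, j \in J -> i != d j - 1) -> h i = 0%N.
  move=> notJ; apply/eqP; rewrite -leqn0 leqNgt; apply/negP => hi.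
  have /card_gt0P[j] := leq_trans hi (h_gens i); rewrite inE => /eqP dj.
  have /card_gt0P[l] := leq_trans (leq_trans hi (h_s i)) (s_tops i); rewrite inE => /eqP ml.
  have /notJ : j \in J.
    by rewrite inE; apply/existsP; exists l; rewrite /d /m dj ml; apply/eqP; lia.
  by rewrite /d dj addrK eqxx.
have h_min j : (h (d j - 1)%R <= minn (s (d j - 1)%R) (mu j))%N.
  rewrite leq_min h_s; have := h_gens (d j - 1); congr (_ <= _)%N.
  by apply: eq_card => j'; rewrite !inE subrK.
have [|D [leD dimD]] := le_dim_qdim (Z1_0 hI (@lclosed_any k n.+1))
    (fun x c c' => Z1_lc x hI (@lclosed_any k n.+1)) (B1_0 hI (@lclosed_any k n.+1))
    (fun x c c' => B1_lc x hI (@lclosed_any k n.+1))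
    (total_le_dim homI (T := 'I_(rk F 1)) (e := fun j => d j - 1) dim_h _).
  by move=> i ni; apply: h0 => j _; apply: ni.
exists h, s, D; split=> //; split=> //.
apply: (leq_trans leD); rewrite [X in (_ <= X)%N]big_mkcond /=; apply: leq_sum => j _.
(* Membership in [J] depends only on d_j, so for j outside [J] no index of [J] has the same degree
   and the term h (d_j - 1) is zero. *)
case: ifPn => [_|jJ]; first exact: h_min.
rewrite h0 // => j' j'J; apply: contraNneq jJ => /addIr eq_d.
by move: j'J; rewrite !inE eq_d.
Qed.
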